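(* Let $r>3+2\sqrt2$ be real and put $\rho=\frac{r-1-\sqrt{r^2-6r+1}}{2r}$. Let $f(z)=r\,\mathrm{Log}(1+z)+\mathrm{Log}(1-z)-\log\rho-i\theta$ for $z=\rho e^{i\theta}$, $\theta\in[-\pi,\pi]$ (principal branches of $\mathrm{Log}$), so that $f(\rho)=r\log(1+\rho)+\log(1-\rho)-\log\rho$, and put $$M=\rho^2f''(\rho)=\rho^2\Big(-\frac{r}{(1+\rho)^2}-\frac{1}{(1-\rho)^2}+\frac1{\rho^2}\Big).$$ For real $\lambda>0$ let $I(\lambda)=\int_{-\pi}^{\pi}\exp\big(\lambda f(\rho e^{i\theta})\big)\frac{d\theta}{2\pi}$. Then $M>0$ and $$\left\vert \frac{\sqrt{2\pi\lambda M}}{\exp(\lambda f(\rho))}I(\lambda)-1\right\vert\le \frac{3(3+2\sqrt2)\pi^5}{256\lambda M^2}+\frac{5(3+2\sqrt2)}{24\lambda M^3}+\frac{\sqrt2\exp\left(-\lambda M\frac{\pi^2}{2}\right)}{\pi^{3/2}\sqrt{\lambda M}}.$$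
   Context: Here $\mathrm{Log}$ denotes the principal branch of the complex logarithm, and $f(\rho e^{i\theta})$ is the function $r\log(1+z)+\log(1-z)-\log z$ evaluated on the circle $|z|=\rho$ with $\log z=\log\rho+i\theta$. *)

(* Defs.v *)
(* Stdlib reals with Coquelicot. *)
From Stdlib Require Import Reals Lra.
From Coquelicot Require Import Coquelicot.

Open Scope R_scope.

Definition Cexp (z : C) : C := (exp (Re z) * cos (Im z), exp (Re z) * sin (Im z)).

(* Principal argument, in (-PI, PI]; its value at 0 is irrelevant. *)
Definition Arg (z : C) : R :=
  if Rle_dec 0 (Im z) then acos (Re z / Cmod z) else - acos (Re z / Cmod z).

Definition Log (z : C) : C := (ln (Cmod z), Arg z).

Definition polar (rho theta : R) : C := (RtoC rho * Cexp (Ci * RtoC theta))%C.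

(* The values of f on the circle of radius rho, where log z = ln rho + i theta.
   No branch is chosen for log z: at theta = -PI this differs from [Log z]. *)
Definition f_circle (r rho theta : R) : C :=
  (RtoC r * Log (1 + polar rho theta) + Log (1 - polar rho theta)
   - RtoC (ln rho) - Ci * RtoC theta)%C.

(* The same function of the complex variable z (see [f_circleE]), holomorphic
   on a neighbourhood of the interval (0, 1): this is the function that is
   differentiated. *)
Definition f_complex (r : R) (z : C) : C :=
  (RtoC r * Log (1 + z) + Log (1 - z) - Log z)%C.

Definition Iint (r rho lambda : R) : C :=
  RInt (V := C_R_CompleteNormedModule)
    (fun theta : R =>
       (Cexp (RtoC lambda * f_circle r rho theta) / RtoC (2 * PI))%C)
    (- PI) PI.

Lemma Cmod_sqr (z : C) : Cmod z * Cmod z = Re z * Re z + Im z * Im z.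
Proof. generalize (Cmod2_alt z); simpl; lra. Qed.

Lemma cos_quot_bound (z : C) : z <> 0%C -> -1 <= Re z / Cmod z <= 1.
Proof.
intros Hz; apply Cmod_gt_0 in Hz.
generalize (re_le_Cmod z); intros H; apply Rabs_le_between in H.
split; [apply Rle_div_r | apply Rle_div_l]; lra.
Qed.

Lemma Arg_bound (z : C) : z <> 0%C -> - PI < Arg z <= PI.
Proof.
intros Hz; pose proof (acos_bound (Re z / Cmod z)) as Hb.
pose proof PI_RGT_0 as Hpi.
unfold Arg; destruct (Rle_dec 0 (Im z)) as [Hi|Hi]; [lra|].
assert (acos (Re z / Cmod z) <> PI); [|lra].
intros Ha; pose proof (cos_acos _ (cos_quot_bound z Hz)) as Hc.
rewrite Ha, cos_PI in Hc; apply Cmod_gt_0 in Hz.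
assert (Hr : Re z = - Cmod z).
{ replace (Re z) with (Re z / Cmod z * Cmod z) by (field; lra).
  rewrite <- Hc; ring. }
pose proof (Cmod_sqr z) as Hs; rewrite Hr in Hs; nra.
Qed.

Lemma Cexp_Log (z : C) : z <> 0%C -> Cexp (Log z) = z.
Proof.
intros Hz; pose proof (cos_quot_bound z Hz) as Hq.
pose proof (Cmod_sqr z) as Hs.
assert (Hm := proj1 (Cmod_gt_0 z) Hz).
assert (Hsq : Cmod z * sqrt (1 - Rsqr (Re z / Cmod z)) = Rabs (Im z)).
{ rewrite <- (sqrt_Rsqr (Cmod z)) at 1 by lra.
  rewrite <- sqrt_mult_alt by apply Rle_0_sqr.
  rewrite <- sqrt_Rsqr_abs; f_equal; unfold Rsqr.
  replace (Cmod z * Cmod z * (1 - Re z / Cmod z * (Re z / Cmod z)))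
    with (Cmod z * Cmod z - Re z * Re z) by (field; lra).
  lra. }
unfold Cexp, Log; cbn [Re Im fst snd]; rewrite (exp_ln _ Hm).
rewrite (surjective_pairing z) at 5; unfold Arg.
change (fst z) with (Re z); change (snd z) with (Im z).
destruct (Rle_dec 0 (Im z)) as [Hi|Hi];
  rewrite ?cos_neg, ?sin_neg, cos_acos, sin_acos by exact Hq; f_equal;
  try (field; lra).
- rewrite Hsq; apply Rabs_pos_eq, Hi.
- rewrite <- Ropp_mult_distr_r, Hsq, Rabs_left; lra.
Qed.

Lemma polarE (rho theta : R) : polar rho theta = (rho * cos theta, rho * sin theta).
Proof.
unfold polar, Cexp, RtoC, Ci, Cmult; cbn [Re Im fst snd].
replace (0 * theta - 1 * 0) with 0 by ring; rewrite exp_0.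
f_equal; replace (0 * 0 + 1 * theta) with theta by ring; ring.
Qed.

Lemma Log_polar (rho theta : R) :
  0 < rho -> - PI < theta <= PI ->
  Log (polar rho theta) = (RtoC (ln rho) + Ci * RtoC theta)%C.
Proof.
intros Hr Ht; rewrite polarE.
assert (Hm : Cmod (rho * cos theta, rho * sin theta) = rho).
{ unfold Cmod; cbn [fst snd].
  replace (_ + _) with (Rsqr rho * (Rsqr (sin theta) + Rsqr (cos theta)))
    by (unfold Rsqr; ring).
  rewrite sin2_cos2, Rmult_1_r; apply sqrt_Rsqr; lra. }
unfold Log, Arg; rewrite Hm; cbn [Re Im fst snd].
replace (rho * cos theta / rho) with (cos theta) by (field; lra).
assert (Ha : (if Rle_dec 0 (rho * sin theta) then acos (cos theta)
              else - acos (cos theta)) = theta).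
{ destruct (Rle_dec 0 (rho * sin theta)) as [Hi|Hi];
    destruct (Rle_dec 0 theta) as [H0|H0].
  - apply acos_cos; lra.
  - assert (sin (- theta) > 0) by (apply sin_gt_0; lra).
    rewrite sin_neg in *; nra.
  - assert (0 <= sin theta) by (apply sin_ge_0; lra); nra.
  - rewrite <- (cos_neg theta), acos_cos; lra. }
rewrite Ha; unfold RtoC, Ci, Cplus, Cmult; cbn [fst snd]; f_equal; ring.
Qed.

Lemma f_circleE (r rho theta : R) :
  0 < rho -> - PI < theta <= PI ->
  f_circle r rho theta = f_complex r (polar rho theta).
Proof.
intros Hr Ht; unfold f_circle, f_complex; rewrite (Log_polar rho theta Hr Ht); ring.
Qed.

(* Main.v *)
Require Import Defs.
From Stdlib Require Import Reals Lra.
From Coquelicot Require Import Coquelicot.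

Open Scope R_scope.

(** With [r = (1 + rho) / (rho (1 - rho))] and [u = 1 - cos t], write
    [f (rho e^(i t)) - f rho = G t + i H t].  Then [|1 + z|^2 = (1 + rho)^2 - 2 rho u]
    and [|1 - z|^2 = (1 - rho)^2 + 2 rho u], so elementary bounds on [ln] give
    [- M u - D u^2 <= G <= - M u], while [H' = - u K] with [|K| <= 1 + sqrt 2].
    Since [2 t^2 / PI^2 <= u <= t^2 / 2], the integrand is dominated by a Gaussian,
    and [exp (lambda G) cos (lambda H)] differs from [exp (- lambda M t^2 / 2)] by
    fourth and sixth Gaussian moments; the odd imaginary part integrates to zero.
    The constants [D <= (3 + 2 sqrt 2) / 2] and [1 + sqrt 2] are attained at
    [rho = sqrt 2 - 1], where [M] vanishes. *)

(** * Elementary inequalities *)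

(** The definition of [rho] encodes the saddle equation [f'(rho) = 0]. Solved for [r], it turns [M],
    [D] and [K] into expressions in [rho] (and [t]) with the single constraint [rho < sqrt 2 - 1],
    and it is what makes the slope of [G] in [u] exactly [- M] and lets the factor [u] split off
    [H']. A quartic error for [G] near 0 is not enough: decay is needed up to [|t| = PI], where
    Jordan's inequality only gives the weaker Gaussian [exp (- 2 lambda M t^2 / PI^2)]. That
    envelope carries the difference of the exponentials, whence the [PI ^ 5] of the first error
    term. The factor [cos (lambda H) - 1], of size [H^2], multiplies the exact Gaussian, so the
    second term is free of [PI]. The third term is the mass of the exact Gaussian outside
    [[-PI, PI]]. The inputs are [k4 = (3 + 2 sqrt 2) / 8], a quarter of the bound on [D], and
    [k3 = (1 + sqrt 2) / 6], from integrating [(1 + sqrt 2) t^2 / 2]; since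
    [(1 + sqrt 2)^2 = 3 + 2 sqrt 2], the same number appears in both terms. No improper integral
    occurs: Gaussian integrals stay on bounded intervals, with explicit errors. *)

Lemma le_of_derive_ge0 (f df : R -> R) (a b : R) :
  a <= b ->
  (forall x, a <= x <= b -> is_derive f x (df x)) ->
  (forall x, a <= x <= b -> 0 <= df x) -> f a <= f b.
Proof.
intros Hab Hd Hp.
destruct (MVT_gen f a b df) as [c [Hc Heq]].
- intros x; rewrite Rmin_left, Rmax_right by lra; intros Hx; apply Hd; lra.
- intros x; rewrite Rmin_left, Rmax_right by lra; intros Hx.
  apply continuity_pt_filterlim, (ex_derive_continuous f).
  exists (df x); apply Hd; lra.
- rewrite Rmin_left, Rmax_right in Hc by lra.
  assert (0 <= df c) by (apply Hp; lra).
  assert (0 <= df c * (b - a)) by (apply Rmult_le_pos; lra); lra.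
Qed.

Lemma ln_1p_le (x : R) : -1 < x -> ln (1 + x) <= x.
Proof.
intros Hx; rewrite <- (ln_exp x) at 2.
apply ln_le; [lra | apply exp_ineq1_le].
Qed.

Lemma ln_1p_ge (y : R) : 0 <= y -> y - y ^ 2 / 2 <= ln (1 + y).
Proof.
intros Hy.
enough (H : ln (1 + 0) - (0 - 0 ^ 2 / 2) <= ln (1 + y) - (y - y ^ 2 / 2)).
{ rewrite Rplus_0_r, ln_1 in H; lra. }
apply (le_of_derive_ge0 (fun x => ln (1 + x) - (x - x ^ 2 / 2))
  (fun x => x ^ 2 / (1 + x)) 0 y Hy).
- intros x Hx; auto_derive; [lra | field; lra].
- intros x Hx; apply Rcomplements.Rdiv_le_0_compat; [apply pow2_ge_0 | lra].
Qed.

(** The difference of the two sides has derivative [x^2 / (2 (1 - x)^2)]. The remainder keeps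
    [1 - x] in its denominator because [x] will run up to a value depending on [rho], where [1 - x]
    has an explicit positive minimum. *)
Lemma ln_1m_ge (x : R) :
  0 <= x < 1 -> - x - x ^ 2 / (2 * (1 - x)) <= ln (1 - x).
Proof.
intros Hx.
enough (H : ln (1 - 0) - (- 0 - 0 ^ 2 / (2 * (1 - 0)))
            <= ln (1 - x) - (- x - x ^ 2 / (2 * (1 - x)))).
{ rewrite Rminus_0_r, ln_1 in H; lra. }
apply (le_of_derive_ge0 (fun x => ln (1 - x) - (- x - x ^ 2 / (2 * (1 - x))))
  (fun x => x ^ 2 / (2 * (1 - x) ^ 2)) 0 x); [lra | | ].
- intros y Hy; auto_derive; [lra | field; lra].
- intros y Hy; apply Rcomplements.Rdiv_le_0_compat; [apply pow2_ge_0 |].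
  assert (0 < (1 - y) ^ 2) by (apply pow_lt; lra); lra.
Qed.

(** The function [sin y - 2 y / PI] vanishes at 0 and at [PI / 2]; it increases up to its critical
    point [a = acos (2 / PI)] and decreases afterwards. So [x] is compared with 0 on the left of [a]
    and with [PI / 2] on the right. *)
Lemma jordan_ineq (x : R) : 0 <= x <= PI / 2 -> 2 * x / PI <= sin x.
Proof.
intros Hx; pose proof PI2_1 as Hpi.
assert (Hq : -1 <= 2 / PI <= 1).
{ split; [apply Rcomplements.Rle_div_r | apply Rcomplements.Rle_div_l]; lra. }
assert (0 <= 2 / PI) by (apply Rlt_le, Rdiv_lt_0_compat; lra).
pose proof (cos_acos _ Hq) as Ha; set (a := acos (2 / PI)) in Ha.
pose proof (acos_bound (2 / PI)) as Hab; fold a in Hab.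
assert (Hd : forall y, is_derive (fun y => sin y - 2 / PI * y) y (cos y - 2 / PI)).
{ intros y; auto_derive; [trivial | ring]. }
destruct (Rle_dec x a) as [Hxa|Hxa].
- enough (H0 : sin 0 - 2 / PI * 0 <= sin x - 2 / PI * x) by (rewrite sin_0 in H0; lra).
  apply (le_of_derive_ge0 (fun y => sin y - 2 / PI * y) (fun y => cos y - 2 / PI) 0 x);
    [lra | auto |].
  intros y Hy; assert (cos a <= cos y) by (apply cos_decr_1; lra); lra.
- enough (H0 : - (sin x - 2 / PI * x) <= - (sin (PI / 2) - 2 / PI * (PI / 2))).
  { rewrite sin_PI2 in H0.
    replace (2 / PI * (PI / 2)) with 1 in H0 by (field; lra); lra. }
  apply (le_of_derive_ge0 (fun y => - (sin y - 2 / PI * y))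
           (fun y => - (cos y - 2 / PI)) x (PI / 2)); [lra | |].
  + intros y _; apply (is_derive_opp (fun y => sin y - 2 / PI * y)), Hd.
  + intros y Hy; assert (cos y <= cos a) by (apply cos_decr_1; lra); lra.
Qed.

Lemma even_reflect (P : R -> Prop) :
  (forall x, P (- x) -> P x) -> (forall x, 0 <= x -> P x) -> forall x, P x.
Proof.
intros He Hp x; destruct (Rle_dec 0 x); [auto | apply He, Hp; lra].
Qed.

Lemma one_minus_cos (x : R) : 1 - cos x = 2 * sin (x / 2) ^ 2.
Proof. replace x with (2 * (x / 2)) at 1 by field; rewrite cos_2a_sin; ring. Qed.

(** Unlike the Taylor bound, this one is useful on all of [[-PI, PI]], with equality at the ends;
    the price is the factor [2 / PI^2] in place of [1 / 2]. *)
Lemma one_minus_cos_ge_jordan (x : R) :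
  - PI <= x <= PI -> 2 * x ^ 2 / PI ^ 2 <= 1 - cos x.
Proof.
revert x; apply (even_reflect (fun x => - PI <= x <= PI -> 2 * x ^ 2 / PI ^ 2 <= 1 - cos x)).
- intros x H Hx; rewrite cos_neg in H.
  replace (x ^ 2) with ((- x) ^ 2) by ring; apply H; lra.
- intros x H0 Hx; rewrite one_minus_cos; pose proof PI_RGT_0.
  assert (Hj : 2 * (x / 2) / PI <= sin (x / 2)) by (apply jordan_ineq; lra).
  replace (2 * x ^ 2 / PI ^ 2) with (2 * (2 * (x / 2) / PI) ^ 2) by (field; lra).
  apply Rmult_le_compat_l; [lra | apply pow_incr; split; [|exact Hj]].
  apply Rcomplements.Rdiv_le_0_compat; lra.
Qed.

Lemma one_minus_cos_le (x : R) : 1 - cos x <= x ^ 2 / 2.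
Proof.
revert x; apply even_reflect.
- intros x; rewrite cos_neg; replace ((- x) ^ 2) with (x ^ 2) by ring; auto.
- intros x H0.
  enough (H : 0 ^ 2 / 2 - (1 - cos 0) <= x ^ 2 / 2 - (1 - cos x))
    by (rewrite cos_0 in H; lra).
  apply (le_of_derive_ge0 (fun x => x ^ 2 / 2 - (1 - cos x)) (fun x => x - sin x)).
  + lra.
  + intros y _; auto_derive; [trivial | field].
  + intros y [[Hy|<-] _]; [|rewrite sin_0; lra].
    pose proof (sin_lt_x y Hy); lra.
Qed.

Lemma one_minus_cos_ge (x : R) : x ^ 2 / 2 - x ^ 4 / 24 <= 1 - cos x.
Proof.
assert (Hs : forall y, 0 <= y -> y - y ^ 3 / 6 <= sin y).
{ intros y Hy.
  enough (H : sin 0 - (0 - 0 ^ 3 / 6) <= sin y - (y - y ^ 3 / 6))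
    by (rewrite sin_0 in H; lra).
  apply (le_of_derive_ge0 (fun y => sin y - (y - y ^ 3 / 6))
           (fun y => y ^ 2 / 2 - (1 - cos y))); [lra | |].
  - intros z _; auto_derive; [trivial | field].
  - intros z _; pose proof (one_minus_cos_le z); lra. }
revert x; apply even_reflect.
- intros x; rewrite cos_neg; replace ((- x) ^ 2) with (x ^ 2) by ring;
    replace ((- x) ^ 4) with (x ^ 4) by ring; auto.
- intros x H0.
  enough (H : 1 - cos 0 - (0 ^ 2 / 2 - 0 ^ 4 / 24) <= 1 - cos x - (x ^ 2 / 2 - x ^ 4 / 24))
    by (rewrite cos_0 in H; lra).
  apply (le_of_derive_ge0 (fun x => 1 - cos x - (x ^ 2 / 2 - x ^ 4 / 24))
           (fun x => sin x - (x - x ^ 3 / 6))); [lra | |].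
  + intros y _; auto_derive; [trivial | field].
  + intros y Hy; pose proof (Hs y); lra.
Qed.

Lemma exp_le_compat (x y : R) : x <= y -> exp x <= exp y.
Proof. intros [H|<-]; [left; apply exp_increasing, H | right; reflexivity]. Qed.

(** A mean value bound drawn from [exp s >= 1 + s] at [s = a - b]. The free majorant [z] will be the
    Jordan exponent, which dominates both the true exponent and its quadratic approximation. *)
Lemma exp_diff_le (x y z : R) :
  x <= z -> y <= z -> Rabs (exp x - exp y) <= Rabs (x - y) * exp z.
Proof.
assert (H : forall a b, a <= b -> b <= z -> Rabs (exp b - exp a) <= Rabs (b - a) * exp z).
{ intros a b Hab Hb.
  assert (exp a <= exp b) by (apply exp_le_compat, Hab).
  assert (exp b <= exp z) by (apply exp_le_compat, Hb).
  rewrite !Rabs_pos_eq by lra.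
  assert (He : exp a = exp b * exp (a - b)) by (rewrite <- exp_plus; f_equal; lra).
  pose proof (exp_ineq1_le (a - b)); pose proof (exp_pos b).
  apply Rle_trans with ((b - a) * exp b); [rewrite He; nra | apply Rmult_le_compat_l; lra]. }
intros Hx Hy; destruct (Rle_dec x y).
- rewrite (Rabs_minus_sym (exp x)), (Rabs_minus_sym x); auto.
- apply H; lra.
Qed.

(** * Gaussian integrals and moments *)

Definition gauss (x : R) : R := RInt (fun t => exp (- t ^ 2)) 0 x.

Lemma continuous_gauss (a x : R) : continuous (fun t => exp (- (a * t ^ 2))) x.
Proof. apply (ex_derive_continuous (fun t => exp (- (a * t ^ 2)))); auto_derive; trivial. Qed.

Lemma continuous_gauss1 (x : R) : continuous (fun t => exp (- t ^ 2)) x.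
Proof. apply (ex_derive_continuous (fun t => exp (- t ^ 2))); auto_derive; trivial. Qed.

Lemma ex_RInt_gauss1 (a b : R) : ex_RInt (fun t => exp (- t ^ 2)) a b.
Proof.
apply (ex_RInt_continuous (V := R_CompleteNormedModule)); intros x _; apply continuous_gauss1.
Qed.

Lemma is_derive_gauss (x : R) : is_derive gauss x (exp (- x ^ 2)).
Proof.
apply (is_derive_RInt (V := R_NormedModule) (fun t => exp (- t ^ 2)) gauss 0 x).
- apply filter_forall; intros y; apply (RInt_correct (V := R_CompleteNormedModule)), ex_RInt_gauss1.
- apply continuous_gauss1.
Qed.

(** The classical companion of the error function: its derivative cancels that of [gauss ^ 2], which
    yields the Gaussian integral without a double integral. *)
Definition gauss_compl (x : R) : R :=
  RInt (fun t => exp (- (x ^ 2 * (1 + t ^ 2))) / (1 + t ^ 2)) 0 1.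

Lemma one_plus_sq_pos (t : R) : 0 < 1 + t ^ 2.
Proof. pose proof (pow2_ge_0 t); lra. Qed.

Lemma ex_RInt_gauss_compl (x : R) :
  ex_RInt (fun t => exp (- (x ^ 2 * (1 + t ^ 2))) / (1 + t ^ 2)) 0 1.
Proof.
apply (ex_RInt_continuous (V := R_CompleteNormedModule)); intros t _.
apply (ex_derive_continuous (fun t => exp (- (x ^ 2 * (1 + t ^ 2))) / (1 + t ^ 2))).
pose proof (one_plus_sq_pos t); auto_derive; repeat split; lra.
Qed.

Lemma is_derive_gauss_compl (x : R) :
  is_derive gauss_compl x (- (2 * exp (- x ^ 2) * gauss x)).
Proof.
assert (Hd : forall u t, is_derive (fun u => exp (- (u ^ 2 * (1 + t ^ 2))) / (1 + t ^ 2)) u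
                 (- (2 * u * exp (- (u ^ 2 * (1 + t ^ 2)))))).
{ intros u t; pose proof (one_plus_sq_pos t).
  auto_derive; [lra |].
  change (u * (u * 1)) with (u ^ 2); change (t * (t * 1)) with (t ^ 2).
  field; lra. }
assert (HD : forall u t, Derive (fun u => exp (- (u ^ 2 * (1 + t ^ 2))) / (1 + t ^ 2)) u
                 = - (2 * u * exp (- (u ^ 2 * (1 + t ^ 2))))).
{ intros u t; apply is_derive_unique, Hd. }
replace (- (2 * exp (- x ^ 2) * gauss x)) with
  (RInt (fun t => Derive (fun u => exp (- (u ^ 2 * (1 + t ^ 2))) / (1 + t ^ 2)) x) 0 1).
{ apply (is_derive_RInt_param (fun x t => exp (- (x ^ 2 * (1 + t ^ 2))) / (1 + t ^ 2)) 0 1 x).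
  - apply filter_forall; intros y t _; eexists; apply Hd.
  - intros t _.
    apply (continuity_2d_pt_ext (fun u t => - (2 * u * exp (- (u ^ 2 * (1 + t ^ 2)))))).
    { intros u v; symmetry; apply HD. }
    apply continuity_2d_pt_opp, continuity_2d_pt_mult.
    + apply continuity_2d_pt_mult; [apply continuity_2d_pt_const | apply continuity_2d_pt_id1].
    + apply (continuity_1d_2d_pt_comp exp).
      { apply derivable_continuous_pt, derivable_pt_exp. }
      apply continuity_2d_pt_opp, continuity_2d_pt_mult.
      * apply (continuity_1d_2d_pt_comp (fun u => u ^ 2)); [reg | apply continuity_2d_pt_id1].
      * apply continuity_2d_pt_plus; [apply continuity_2d_pt_const |].
        apply (continuity_1d_2d_pt_comp (fun u => u ^ 2)); [reg | apply continuity_2d_pt_id2].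
  - apply filter_forall; intros y; apply ex_RInt_gauss_compl. }
apply is_RInt_unique.
(* The factor [exp (- x^2)] leaves the integral, and [s = x t] turns the rest into [gauss x]. The
   [+ 0] is the shape of the affine substitution in [is_RInt_comp_lin]. *)
apply (is_RInt_ext (fun t => scal (- (2 * exp (- x ^ 2))) (scal x (exp (- (x * t + 0) ^ 2))))).
{ intros t _; rewrite HD; unfold scal; simpl; unfold mult; simpl.
  replace (- (x * (x * 1) * (1 + t * (t * 1)))) with
    (- (x * (x * 1)) + - ((x * t + 0) * ((x * t + 0) * 1))) by ring.
  rewrite exp_plus; ring. }
replace (- (2 * exp (- x ^ 2) * gauss x)) with (scal (- (2 * exp (- x ^ 2))) (gauss x))
  by (unfold scal; simpl; unfold mult; simpl; ring).
apply (is_RInt_scal (V := R_NormedModule)), (is_RInt_comp_lin (fun t => exp (- t ^ 2)) x 0 0 1).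
rewrite Rmult_0_r, Rplus_0_r, Rmult_1_r, Rplus_0_r.
apply (RInt_correct (V := R_CompleteNormedModule)), ex_RInt_gauss1.
Qed.

Lemma RInt_atan_derivative : RInt (fun t => / (1 + t ^ 2)) 0 1 = PI / 4.
Proof.
apply is_RInt_unique.
replace (PI / 4) with (minus (atan 1) (atan 0))
  by (rewrite atan_1, atan_0; unfold minus, plus, opp; simpl; lra).
apply (is_RInt_derive (V := R_CompleteNormedModule) atan).
- intros t _; apply is_derive_Reals, derivable_pt_lim_atan.
- intros t _; apply (ex_derive_continuous (fun t => / (1 + t ^ 2))).
  pose proof (one_plus_sq_pos t); auto_derive; lra.
Qed.

Lemma is_derive_eq (f : R -> R) (x l l' : R) :
  l = l' -> is_derive f x l -> is_derive f x l'.
Proof. intros ->; auto. Qed.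

(** The derivative of the sum is zero, and at 0 the sum reduces to the integral of [1 / (1 + t^2)]
    over [[0, 1]]. *)
Lemma gauss_sqr (x : R) : 0 <= x -> gauss x ^ 2 + gauss_compl x = PI / 4.
Proof.
intros Hx.
assert (H0 : gauss 0 ^ 2 + gauss_compl 0 = PI / 4).
{ unfold gauss; rewrite RInt_point; unfold zero; simpl.
  rewrite <- RInt_atan_derivative; unfold gauss_compl.
  rewrite Rmult_0_l, Rplus_0_l; apply RInt_ext; intros t _.
  replace (- (0 ^ 2 * (1 + t ^ 2))) with 0 by ring; rewrite exp_0; apply Rmult_1_l. }
rewrite <- H0; destruct Hx as [Hx|<-]; [|reflexivity].
symmetry; apply (eq_is_derive (V := R_NormedModule) (fun x => gauss x ^ 2 + gauss_compl x));
  [|exact Hx].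
intros t _.
apply (is_derive_eq (fun x => gauss x ^ 2 + gauss_compl x) _
         (2 * exp (- t ^ 2) * gauss t + - (2 * exp (- t ^ 2) * gauss t)));
  [apply Rplus_opp_r |].
apply (is_derive_plus (fun x => gauss x ^ 2)); [|apply is_derive_gauss_compl].
apply (is_derive_ext (fun x => gauss x * gauss x)); [intros; simpl; ring |].
replace (2 * exp (- t ^ 2) * gauss t) with
  (plus (mult (exp (- t ^ 2)) (gauss t)) (mult (gauss t) (exp (- t ^ 2))))
  by (unfold plus, mult; simpl; ring).
apply (is_derive_mult gauss gauss); try apply is_derive_gauss; apply Rmult_comm.
Qed.

(** With [gauss_sqr] this brackets [gauss x ^ 2] between [PI / 4 * (1 - exp (- x^2))] and [PI / 4],
    which replaces the limit at infinity by an explicit rate. *)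
Lemma gauss_compl_bounds (x : R) : 0 <= gauss_compl x <= PI / 4 * exp (- x ^ 2).
Proof.
pose proof (pow2_ge_0 x) as Hx2.
split; unfold gauss_compl.
- apply RInt_ge_0; [lra | apply ex_RInt_gauss_compl |].
  intros t _; apply Rlt_le, Rdiv_lt_0_compat; [apply exp_pos | apply one_plus_sq_pos].
- rewrite <- RInt_atan_derivative.
  assert (Hex : ex_RInt (fun t => / (1 + t ^ 2)) 0 1).
  { apply (ex_RInt_continuous (V := R_CompleteNormedModule)); intros t _.
    apply (ex_derive_continuous (fun t => / (1 + t ^ 2))).
    pose proof (one_plus_sq_pos t); auto_derive; lra. }
  rewrite Rmult_comm.
  change (exp (- x ^ 2) * RInt (fun t => / (1 + t ^ 2)) 0 1) with
    (scal (exp (- x ^ 2)) (RInt (fun t => / (1 + t ^ 2)) 0 1)).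
  rewrite <- (RInt_scal (V := R_CompleteNormedModule)) by exact Hex.
  apply RInt_le; [lra | apply ex_RInt_gauss_compl | |].
  + apply (ex_RInt_scal (V := R_NormedModule)), Hex.
  + intros t _; pose proof (pow2_ge_0 t).
    apply Rmult_le_compat_r; [apply Rlt_le, Rinv_0_lt_compat, one_plus_sq_pos |].
    assert (0 <= x ^ 2 * t ^ 2) by (apply Rmult_le_pos; lra).
    apply exp_le_compat; lra.
Qed.

Lemma gauss_ge_0 (x : R) : 0 <= x -> 0 <= gauss x.
Proof.
intros Hx; apply RInt_ge_0; [exact Hx | apply ex_RInt_gauss1 |].
intros t _; apply Rlt_le, exp_pos.
Qed.

Lemma gauss_le (x : R) : 0 <= x -> gauss x <= sqrt PI / 2.
Proof.
intros Hx; pose proof (gauss_sqr x Hx); pose proof (gauss_compl_bounds x).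
pose proof (sqrt_pos PI); pose proof (sqrt_sqrt PI (Rlt_le _ _ PI_RGT_0)).
pose proof (gauss_ge_0 x Hx).
apply Rsqr_incr_0_var; [unfold Rsqr; nra | lra].
Qed.

(* Beyond [x] the integrand is at most [(t / x) exp (- t ^ 2)], which has an
   elementary primitive. *)
Lemma gauss_tail (x : R) : 0 < x -> sqrt PI / 2 - exp (- x ^ 2) / (2 * x) <= gauss x.
Proof.
intros Hx.
assert (Hinc : forall y, x <= y -> gauss y <= gauss x + exp (- x ^ 2) / (2 * x)).
{ intros y Hy.
  enough (H : - gauss x - exp (- x ^ 2) / (2 * x) <= - gauss y - exp (- y ^ 2) / (2 * x)).
  { assert (0 < exp (- y ^ 2) / (2 * x)) by (apply Rdiv_lt_0_compat; [apply exp_pos | lra]).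
    lra. }
  apply (le_of_derive_ge0 (fun y => - gauss y - exp (- y ^ 2) / (2 * x))
           (fun y => (y - x) / x * exp (- y ^ 2))); [exact Hy | |].
  - intros t _.
    replace ((t - x) / x * exp (- t ^ 2)) with
      (minus (opp (exp (- t ^ 2))) (- (2 * t) * exp (- t ^ 2) / (2 * x)))
      by (unfold minus, plus, opp; simpl; field; lra).
    apply (is_derive_minus (fun y => - gauss y)).
    + apply (is_derive_opp gauss), is_derive_gauss.
    + auto_derive; [trivial |].
      change (t * (t * 1)) with (t ^ 2); field; lra.
  - intros t Ht; apply Rmult_le_pos; [|apply Rlt_le, exp_pos].
    apply Rcomplements.Rdiv_le_0_compat; lra. }
set (c := gauss x + exp (- x ^ 2) / (2 * x)) in Hinc.
enough (sqrt PI / 2 <= c) by (unfold c in *; lra).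
assert (Hc : 0 <= c).
{ apply Rle_trans with (gauss x); [apply gauss_ge_0; lra | apply Hinc; lra]. }
pose proof (sqrt_pos PI); pose proof (sqrt_sqrt PI (Rlt_le _ _ PI_RGT_0)).
pose proof PI_RGT_0 as Hpi.
apply Rsqr_incr_0_var; [|exact Hc].
(* If [c] were below [sqrt PI / 2], then [e = 1 - 4 c^2 / PI] would be positive. The point [y] is
   taken beyond both [x] and [/ e], so that [exp (y^2) >= 1 + y^2 > / e]; then [gauss y ^ 2 >= PI /
   4 * (1 - exp (- y^2)) > c^2], against [gauss y <= c]. *)
apply Rnot_lt_le; intros Hlt.
assert (Hgap : 0 < 1 - 4 / PI * c ^ 2).
{ replace (4 / PI * c ^ 2) with (c ^ 2 / (PI / 4)) by (field; lra).
  enough (c ^ 2 / (PI / 4) < 1) by lra.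
  apply Rcomplements.Rlt_div_l; [lra | unfold Rsqr in Hlt; nra]. }
set (e := 1 - 4 / PI * c ^ 2) in Hgap.
set (y := x + 1 + / e).
assert (Hie : 0 < / e) by (apply Rinv_0_lt_compat, Hgap).
assert (Hy : c ^ 2 >= PI / 4 - PI / 4 * exp (- y ^ 2)).
{ assert (Hgy : gauss y <= c) by (apply Hinc; unfold y; lra).
  assert (0 <= y) by (unfold y; lra).
  pose proof (gauss_ge_0 y); pose proof (gauss_sqr y).
  pose proof (gauss_compl_bounds y); nra. }
assert (Hexp : exp (- y ^ 2) < e).
{ rewrite exp_Ropp; rewrite <- (Rinv_inv e).
  apply Rinv_lt_contravar; [apply Rmult_lt_0_compat; [exact Hie | apply exp_pos] |].
  pose proof (exp_ineq1_le (y ^ 2)); assert (/ e < y) by (unfold y; lra).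
  assert (1 < y) by (unfold y; lra); nra. }
assert (He : PI / 4 * e = PI / 4 - c ^ 2) by (unfold e; field; lra).
nra.
Qed.

Lemma gauss_opp (x : R) : gauss (- x) = - gauss x.
Proof.
unfold gauss; symmetry.
pose proof (is_RInt_comp_lin (V := R_NormedModule) (fun t => exp (- t ^ 2)) (-1) 0 0 x
  (RInt (fun t => exp (- t ^ 2)) 0 (- x))) as H.
rewrite Rmult_0_r, !Rplus_0_r in H.
replace (-1 * x) with (- x) in H by ring.
rewrite <- (is_RInt_unique _ _ _ _
  (H (RInt_correct (V := R_CompleteNormedModule) _ _ _ (ex_RInt_gauss1 _ _)))).
symmetry; apply is_RInt_unique.
apply (is_RInt_ext (fun t => opp (exp (- t ^ 2)))).
{ intros t _; unfold scal, opp; simpl; unfold mult; simpl.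
  replace ((-1 * t + 0) * ((-1 * t + 0) * 1)) with (t * (t * 1)) by ring; ring. }
apply (is_RInt_opp (V := R_NormedModule)), (RInt_correct (V := R_CompleteNormedModule)).
apply ex_RInt_gauss1.
Qed.

Lemma ex_RInt_gauss_poly (n : nat) (a x y : R) :
  ex_RInt (fun t => t ^ n * exp (- (a * t ^ 2))) x y.
Proof.
apply (ex_RInt_continuous (V := R_CompleteNormedModule)); intros t _.
apply (continuous_mult (fun t => t ^ n)); [|apply continuous_gauss].
apply (ex_derive_continuous (fun t => t ^ n)); auto_derive; trivial.
Qed.

Lemma ex_RInt_gauss (a x y : R) : ex_RInt (fun t => exp (- (a * t ^ 2))) x y.
Proof.
apply (ex_RInt_continuous (V := R_CompleteNormedModule)); intros t _; apply continuous_gauss.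
Qed.

Lemma RInt_gauss_sym (a x : R) :
  0 < a ->
  RInt (fun t => exp (- (a * t ^ 2))) (- x) x = 2 * gauss (sqrt a * x) / sqrt a.
Proof.
intros Ha; pose proof (sqrt_lt_R0 a Ha) as Hs; pose proof (sqrt_sqrt a (Rlt_le _ _ Ha)) as Hss.
apply is_RInt_unique.
replace (2 * gauss (sqrt a * x) / sqrt a) with
  (minus (gauss (sqrt a * x) / sqrt a) (gauss (sqrt a * - x) / sqrt a)).
2:{ replace (sqrt a * - x) with (- (sqrt a * x)) by ring; rewrite gauss_opp.
    unfold minus, plus, opp; simpl; field; lra. }
apply (is_RInt_derive (V := R_CompleteNormedModule) (fun t => gauss (sqrt a * t) / sqrt a));
  [|intros; apply continuous_gauss].
intros t _.
apply (is_derive_eq (fun t => gauss (sqrt a * t) / sqrt a) _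
  (scal (sqrt a) (exp (- (sqrt a * t) ^ 2)) * / sqrt a)).
{ unfold scal; simpl; unfold mult; simpl.
  replace (sqrt a * t * (sqrt a * t * 1)) with (sqrt a * sqrt a * (t * (t * 1))) by ring.
  rewrite Hss; field; lra. }
apply (is_derive_scal_l (V := R_NormedModule) (fun t => gauss (sqrt a * t))).
apply (is_derive_comp gauss (fun t => sqrt a * t)); [apply is_derive_gauss |].
auto_derive; [trivial | ring].
Qed.

Lemma RInt_gauss_le (a x : R) :
  0 < a -> 0 <= x -> RInt (fun t => exp (- (a * t ^ 2))) (- x) x <= sqrt PI / sqrt a.
Proof.
intros Ha Hx; rewrite RInt_gauss_sym by exact Ha.
pose proof (sqrt_lt_R0 a Ha).
apply Rmult_le_compat_r; [apply Rlt_le, Rinv_0_lt_compat; lra |].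
assert (gauss (sqrt a * x) <= sqrt PI / 2) by (apply gauss_le, Rmult_le_pos; lra); lra.
Qed.

Lemma RInt_gauss_ge (a x : R) :
  0 < a -> 0 < x ->
  sqrt PI / sqrt a - exp (- (a * x ^ 2)) / (a * x)
  <= RInt (fun t => exp (- (a * t ^ 2))) (- x) x.
Proof.
intros Ha Hx; rewrite RInt_gauss_sym by exact Ha.
pose proof (sqrt_lt_R0 a Ha) as Hs; pose proof (sqrt_sqrt a (Rlt_le _ _ Ha)) as Hss.
pose proof (gauss_tail (sqrt a * x) (Rmult_lt_0_compat _ _ Hs Hx)) as Ht.
replace ((sqrt a * x) ^ 2) with (a * x ^ 2) in Ht by (rewrite <- Hss at 1; ring).
replace (sqrt PI / sqrt a - exp (- (a * x ^ 2)) / (a * x)) with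
  (2 * (sqrt PI / 2 - exp (- (a * x ^ 2)) / (2 * (sqrt a * x))) / sqrt a).
- apply Rmult_le_compat_r; [apply Rlt_le, Rinv_0_lt_compat; lra | lra].
- set (e := exp _); replace (a * x) with (sqrt a * sqrt a * x) by (rewrite Hss; ring).
  field; lra.
Qed.

(** Repeated integration by parts packed into one primitive: [p] solves [2 a t p - p' = t^n - c],
    where [c] is the normalised full-line moment. The boundary contribution is
    [- (p x - p (- x)) exp (- a x^2)], which is nonpositive and is dropped. *)
Lemma RInt_gauss_moment (n : nat) (p : R -> R) (c a x : R) :
  0 <= x ->
  (forall t, is_derive (fun t => - (p t * exp (- (a * t ^ 2)))) t
               (t ^ n * exp (- (a * t ^ 2)) - c * exp (- (a * t ^ 2)))) ->
  p (- x) <= p x ->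
  RInt (fun t => t ^ n * exp (- (a * t ^ 2))) (- x) x
  <= c * RInt (fun t => exp (- (a * t ^ 2))) (- x) x.
Proof.
intros Hx Hd Hp.
assert (HI : is_RInt (fun t => t ^ n * exp (- (a * t ^ 2)) - c * exp (- (a * t ^ 2))) (- x) x
               (minus (- (p x * exp (- (a * x ^ 2)))) (- (p (- x) * exp (- (a * (- x) ^ 2)))))).
{ apply (is_RInt_derive (V := R_CompleteNormedModule) (fun t => - (p t * exp (- (a * t ^ 2))))).
  - intros t _; apply Hd.
  - intros t _.
    apply (ex_derive_continuous (fun t => t ^ n * exp (- (a * t ^ 2)) - c * exp (- (a * t ^ 2)))).
    auto_derive; trivial. }
apply (is_RInt_unique (V := R_CompleteNormedModule)) in HI.
rewrite (RInt_minus (V := R_CompleteNormedModule) (fun t => t ^ n * exp (- (a * t ^ 2)))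
  (fun t => c * exp (- (a * t ^ 2)))) in HI;
  [| apply ex_RInt_gauss_poly
   | apply (ex_RInt_scal (V := R_NormedModule)), ex_RInt_gauss].
rewrite (RInt_scal (V := R_CompleteNormedModule) (fun t => exp (- (a * t ^ 2)))) in HI
  by apply ex_RInt_gauss.
replace ((- x) ^ 2) with (x ^ 2) in HI by ring.
unfold minus, plus, opp, scal in HI; simpl in HI; unfold mult in HI; simpl in HI.
pose proof (exp_pos (- (a * (x * (x * 1))))) as He.
assert (p (- x) * exp (- (a * (x * (x * 1)))) <= p x * exp (- (a * (x * (x * 1)))))
  by (apply Rmult_le_compat_r; lra).
simpl; lra.
Qed.

Lemma RInt_gauss_moment4 (a x : R) :
  0 < a -> 0 <= x ->
  RInt (fun t => t ^ 4 * exp (- (a * t ^ 2))) (- x) x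
  <= 3 / (4 * a ^ 2) * (sqrt PI / sqrt a).
Proof.
intros Ha Hx.
assert (H4 : 0 < 3 / (4 * a ^ 2)).
{ apply Rdiv_lt_0_compat; [lra | pose proof (pow_lt a 2 Ha); lra]. }
eapply Rle_trans.
2:{ apply Rmult_le_compat_l; [apply Rlt_le, H4 | apply (RInt_gauss_le a x Ha Hx)]. }
(* Coefficients are found from the top degree downwards in [2 a t p - p' = t^4 - c]; the last one
   fixes [c = 3 / (4 a^2)]. They are positive and [p] is odd, which gives the sign of the boundary
   term. *)
apply (RInt_gauss_moment 4 (fun t => t ^ 3 / (2 * a) + 3 * t / (4 * a ^ 2))); [exact Hx | |].
- intros t; auto_derive; [trivial |].
  change (t * (t * 1)) with (t ^ 2); field; lra.
- assert (0 <= x ^ 3 / (2 * a)).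
  { apply Rdiv_le_0_compat; [apply pow_le, Hx | lra]. }
  assert (0 <= 3 * x / (4 * a ^ 2)).
  { apply Rdiv_le_0_compat; [lra | pose proof (pow_lt a 2 Ha); lra]. }
  replace ((- x) ^ 3 / (2 * a) + 3 * - x / (4 * a ^ 2)) with
    (- (x ^ 3 / (2 * a) + 3 * x / (4 * a ^ 2))) by (field; lra).
  lra.
Qed.

Lemma RInt_gauss_moment6 (a x : R) :
  0 < a -> 0 <= x ->
  RInt (fun t => t ^ 6 * exp (- (a * t ^ 2))) (- x) x
  <= 15 / (8 * a ^ 3) * (sqrt PI / sqrt a).
Proof.
intros Ha Hx.
assert (H3 : 0 < 8 * a ^ 3) by (pose proof (pow_lt a 3 Ha); lra).
assert (H2 : 0 < 4 * a ^ 2) by (pose proof (pow_lt a 2 Ha); lra).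
eapply Rle_trans.
2:{ apply Rmult_le_compat_l; [| apply (RInt_gauss_le a x Ha Hx)].
    apply Rlt_le, Rdiv_lt_0_compat; [lra | exact H3]. }
apply (RInt_gauss_moment 6 (fun t => t ^ 5 / (2 * a) + 5 * t ^ 3 / (4 * a ^ 2)
                                      + 15 * t / (8 * a ^ 3))); [exact Hx | |].
- intros t; auto_derive; [trivial |].
  change (t * (t * 1)) with (t ^ 2); field; lra.
- assert (0 <= x ^ 5 / (2 * a)) by (apply Rdiv_le_0_compat; [apply pow_le, Hx | lra]).
  assert (0 <= 5 * x ^ 3 / (4 * a ^ 2)).
  { apply Rdiv_le_0_compat; [pose proof (pow_le x 3 Hx); lra | exact H2]. }
  assert (0 <= 15 * x / (8 * a ^ 3)) by (apply Rdiv_le_0_compat; [lra | exact H3]).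
  replace ((- x) ^ 5 / (2 * a) + 5 * (- x) ^ 3 / (4 * a ^ 2) + 15 * - x / (8 * a ^ 3)) with
    (- (x ^ 5 / (2 * a) + 5 * x ^ 3 / (4 * a ^ 2) + 15 * x / (8 * a ^ 3))) by (field; lra).
  lra.
Qed.

(** * Comparison with a Gaussian on [[-PI, PI]] *)

(** The error splits into a modulus error times [cos (l h)] and the exact Gaussian times
    [cos (l h) - 1]. Only the first needs the weaker envelope; the second is quadratic in [h], so a
    cubic bound on [h] yields [t^6]. *)
Lemma laplace_pointwise (l M k4 k3 t g h : R) :
  0 < l -> 0 < M ->
  g <= - (2 * M * t ^ 2 / PI ^ 2) ->
  Rabs (g + M * t ^ 2 / 2) <= k4 * t ^ 4 ->
  h ^ 2 <= k3 ^ 2 * t ^ 6 ->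
  Rabs (exp (l * g) * cos (l * h) - exp (- (l * M / 2 * t ^ 2)))
  <= l * k4 * (t ^ 4 * exp (- (2 * l * M / PI ^ 2 * t ^ 2)))
     + l ^ 2 * k3 ^ 2 / 2 * (t ^ 6 * exp (- (l * M / 2 * t ^ 2))).
Proof.
intros Hl HM Hg Hq Hh.
pose proof PI2_1 as Hpi; pose proof (pow2_ge_0 t) as Ht.
replace (exp (l * g) * cos (l * h) - exp (- (l * M / 2 * t ^ 2))) with
  ((exp (l * g) - exp (- (l * M / 2 * t ^ 2))) * cos (l * h)
   + exp (- (l * M / 2 * t ^ 2)) * (cos (l * h) - 1)) by ring.
eapply Rle_trans; [apply Rabs_triang |]; rewrite !Rabs_mult.
apply Rplus_le_compat.
- assert (Hc : Rabs (cos (l * h)) <= 1) by (apply Rabs_le, COS_bound).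
  (* Since [PI >= 2], the Jordan exponent also dominates that of the exact Gaussian, as
     [exp_diff_le] requires. *)
  assert (Hz : M * t ^ 2 / 2 >= 2 * M * t ^ 2 / PI ^ 2).
  { apply Rle_ge, Rle_div_l; [apply pow_lt; lra |].
    assert (0 <= M * t ^ 2 * (PI ^ 2 - 4)); [|lra].
    apply Rmult_le_pos; [apply Rmult_le_pos; lra | nra]. }
  assert (He : Rabs (exp (l * g) - exp (- (l * M / 2 * t ^ 2)))
    <= Rabs (l * g - - (l * M / 2 * t ^ 2)) * exp (- (2 * l * M / PI ^ 2 * t ^ 2))).
  { replace (- (2 * l * M / PI ^ 2 * t ^ 2)) with (l * - (2 * M * t ^ 2 / PI ^ 2))
      by (field; lra).
    apply exp_diff_le.
    - apply Rmult_le_compat_l; lra.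
    - replace (- (l * M / 2 * t ^ 2)) with (l * - (M * t ^ 2 / 2)) by field.
      apply Rmult_le_compat_l; lra. }
  replace (l * g - - (l * M / 2 * t ^ 2)) with (l * (g + M * t ^ 2 / 2)) in He by field.
  rewrite Rabs_mult, (Rabs_pos_eq l) in He by lra.
  apply Rle_trans with (1 := Rmult_le_compat_l _ _ _ (Rabs_pos _) Hc).
  rewrite Rmult_1_r; apply Rle_trans with (1 := He).
  rewrite <- Rmult_assoc; apply Rmult_le_compat_r; [apply Rlt_le, exp_pos |].
  rewrite Rmult_assoc; apply Rmult_le_compat_l; lra.
- rewrite (Rabs_pos_eq (exp _)) by apply Rlt_le, exp_pos.
  rewrite (Rmult_comm (t ^ 6)), <- Rmult_assoc, (Rmult_comm _ (exp _)), Rmult_assoc.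
  apply Rmult_le_compat_l; [apply Rlt_le, exp_pos |].
  pose proof (one_minus_cos_le (l * h)); pose proof (COS_bound (l * h)).
  rewrite Rabs_left1 by lra.
  apply Rle_trans with ((l * h) ^ 2 / 2); [lra |].
  pose proof (Rmult_le_compat_l (l ^ 2 / 2) _ _ ltac:(pose proof (pow2_ge_0 l); lra) Hh); lra.
Qed.

(** The prefactor is [sqrt (l M / (2 PI))], the inverse of the full-line integral of
    [exp (- l M t^2 / 2)]. The three errors are a fourth moment, a sixth moment and a Gaussian
    tail. *)
Lemma laplace_bound (G H : R -> R) (l M k4 k3 : R) :
  0 < l -> 0 < M ->
  (forall t, continuous G t) -> (forall t, continuous H t) ->
  (forall t, - PI <= t <= PI -> G t <= - (2 * M * t ^ 2 / PI ^ 2)) ->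
  (forall t, - PI <= t <= PI -> Rabs (G t + M * t ^ 2 / 2) <= k4 * t ^ 4) ->
  (forall t, H t ^ 2 <= k3 ^ 2 * t ^ 6) -> 0 <= k4 ->
  Rabs (sqrt (2 * PI * l * M) / (2 * PI)
        * RInt (fun t => exp (l * G t) * cos (l * H t)) (- PI) PI - 1)
  <= 3 * k4 * PI ^ 5 / (32 * l * M ^ 2) + 15 * k3 ^ 2 / (2 * l * M ^ 3)
     + sqrt 2 * exp (- (l * M * (PI ^ 2 / 2))) / (PI * sqrt PI * sqrt (l * M)).
Proof.
intros Hl HM HcG HcH HG HQ HH Hk4.
pose proof PI_RGT_0 as Hpi.
set (J := RInt _ _ _).
assert (HlM : 0 < l * M) by (apply Rmult_lt_0_compat; lra).
set (a := 2 * l * M / PI ^ 2); set (b := l * M / 2).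
assert (Ha : 0 < a) by (apply Rdiv_lt_0_compat; [lra | apply pow_lt; lra]).
assert (Hb : 0 < b) by (unfold b; lra).
assert (HexJ : ex_RInt (fun t => exp (l * G t) * cos (l * H t)) (- PI) PI).
{ apply (ex_RInt_continuous (V := R_CompleteNormedModule)); intros t _.
  apply (continuous_mult (fun t => exp (l * G t)) (fun t => cos (l * H t))).
  - apply (continuous_comp (fun t => l * G t) exp);
      [apply (continuous_scal_r (V := R_NormedModule) l G), HcG |].
    apply (ex_derive_continuous exp); auto_derive; trivial.
  - apply (continuous_comp (fun t => l * H t) cos);
      [apply (continuous_scal_r (V := R_NormedModule) l H), HcH |].
    apply (ex_derive_continuous cos); auto_derive; trivial. }
set (Gb := RInt (fun t => exp (- (b * t ^ 2))) (- PI) PI).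
set (M4 := RInt (fun t => t ^ 4 * exp (- (a * t ^ 2))) (- PI) PI).
set (M6 := RInt (fun t => t ^ 6 * exp (- (b * t ^ 2))) (- PI) PI).
assert (Hdiff : Rabs (J - Gb) <= l * k4 * M4 + l ^ 2 * k3 ^ 2 / 2 * M6).
{ set (d := fun t => exp (l * G t) * cos (l * H t) - exp (- (b * t ^ 2))).
  set (e := fun t => l * k4 * (t ^ 4 * exp (- (a * t ^ 2)))
                     + l ^ 2 * k3 ^ 2 / 2 * (t ^ 6 * exp (- (b * t ^ 2)))).
  assert (Hd : is_RInt d (- PI) PI (J - Gb)).
  { apply (is_RInt_minus (V := R_NormedModule)); apply (RInt_correct (V := R_CompleteNormedModule));
      [exact HexJ | apply ex_RInt_gauss]. }
  assert (He : is_RInt e (- PI) PI (l * k4 * M4 + l ^ 2 * k3 ^ 2 / 2 * M6)).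
  { apply (is_RInt_plus (V := R_NormedModule)); apply (is_RInt_scal (V := R_NormedModule));
      apply (RInt_correct (V := R_CompleteNormedModule)), ex_RInt_gauss_poly. }
  apply (norm_RInt_le (V := R_NormedModule) d e (- PI) PI); [lra | | exact Hd | exact He].
  intros t Ht; apply laplace_pointwise; auto. }
assert (HM4 : M4 <= 3 / (4 * a ^ 2) * (sqrt PI / sqrt a))
  by (apply RInt_gauss_moment4; lra).
assert (HM6 : M6 <= 15 / (8 * b ^ 3) * (sqrt PI / sqrt b))
  by (apply RInt_gauss_moment6; lra).
assert (HGle : Gb <= sqrt PI / sqrt b) by (apply RInt_gauss_le; lra).
assert (HGge : sqrt PI / sqrt b - exp (- (b * PI ^ 2)) / (b * PI) <= Gb)
  by (apply RInt_gauss_ge; lra).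
(* All radicals are expressed through [s], [p], [q], so that [field] can work with them as atoms and
   only their squares are rewritten by hand. *)
set (s := sqrt (l * M)) in *; set (p := sqrt PI) in *; set (q := sqrt 2).
assert (Hs : 0 < s) by (apply sqrt_lt_R0, HlM).
assert (Hp : 0 < p) by (apply sqrt_lt_R0, Hpi).
assert (Hq : 0 < q) by (apply sqrt_lt_R0; lra).
assert (Hss : s * s = l * M) by (apply sqrt_sqrt; lra).
assert (Hpp : p * p = PI) by (apply sqrt_sqrt; lra).
assert (Hqq : q * q = 2) by (apply sqrt_sqrt; lra).
assert (Hsa : sqrt a = q * s / PI).
{ apply sqrt_lem_1; [lra | apply Rdiv_le_0_compat; [apply Rmult_le_pos; lra | lra] |].
  unfold a; replace (q * s / PI * (q * s / PI)) with (q * q * (s * s) / PI ^ 2) by (field; lra).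
  rewrite Hqq, Hss; field; lra. }
assert (Hsb : sqrt b = s / q).
{ apply sqrt_lem_1; [lra | apply Rdiv_le_0_compat; lra |].
  unfold b; replace (s / q * (s / q)) with (s * s / (q * q)) by (field; lra).
  rewrite Hqq, Hss; field; lra. }
assert (Hn : sqrt (2 * PI * l * M) / (2 * PI) = s / (q * p)).
{ replace (sqrt (2 * PI * l * M)) with (q * p * s).
  - rewrite <- Hpp; replace 2 with (q * q); field; lra.
  - symmetry; replace (2 * PI * l * M) with ((q * p * s) * (q * p * s)).
    + apply sqrt_square, Rmult_le_pos; [apply Rmult_le_pos |]; lra.
    + replace (q * p * s * (q * p * s)) with ((q * q) * (p * p) * (s * s)) by ring.
      rewrite Hqq, Hpp, Hss; ring. }
rewrite Hn; set (n := s / (q * p)).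
assert (Hn0 : 0 < n) by (apply Rdiv_lt_0_compat; [lra | apply Rmult_lt_0_compat; lra]).
rewrite Hsa in HM4; rewrite Hsb in HM6, HGle, HGge.
assert (E0 : n * (p / (s / q)) = 1) by (unfold n; field; lra).
assert (E1 : n * (l * k4 * (3 / (4 * a ^ 2) * (p / (q * s / PI))))
             = 3 * k4 * PI ^ 5 / (32 * l * M ^ 2)).
{ unfold n, a.
  replace (s / (q * p) * (l * k4 * (3 / (4 * (2 * l * M / PI ^ 2) ^ 2) * (p / (q * s / PI)))))
    with (3 * k4 * PI ^ 5 / (16 * (q * q) * l * M ^ 2)) by (field; lra).
  rewrite Hqq; field; lra. }
assert (E2 : n * (l ^ 2 * k3 ^ 2 / 2 * (15 / (8 * b ^ 3) * (p / (s / q))))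
             = 15 * k3 ^ 2 / (2 * l * M ^ 3)).
{ unfold n, b; field; lra. }
assert (E3 : n * (exp (- (b * PI ^ 2)) / (b * PI))
             = q * exp (- (l * M * (PI ^ 2 / 2))) / (PI * p * s)).
{ replace (- (b * PI ^ 2)) with (- (l * M * (PI ^ 2 / 2))) by (unfold b; field).
  replace b with (s * s / (q * q)) by (unfold b; rewrite Hss, Hqq; field).
  unfold n; field; lra. }
rewrite <- E1, <- E2, <- E3, <- E0.
replace (n * J - n * (p / (s / q))) with (n * (J - Gb) + n * (Gb - p / (s / q))) by ring.
eapply Rle_trans; [apply Rabs_triang |].
rewrite !Rabs_mult, (Rabs_pos_eq n) by lra.
rewrite <- !Rmult_plus_distr_l.
apply Rmult_le_compat_l; [lra |].
rewrite (Rabs_left1 (Gb - _)) by lra.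
assert (l * k4 * M4 <= l * k4 * (3 / (4 * a ^ 2) * (p / (q * s / PI)))).
{ apply Rmult_le_compat_l; [apply Rmult_le_pos; lra | exact HM4]. }
assert (l ^ 2 * k3 ^ 2 / 2 * M6 <= l ^ 2 * k3 ^ 2 / 2 * (15 / (8 * b ^ 3) * (p / (s / q)))).
{ apply Rmult_le_compat_l; [|exact HM6].
  assert (0 <= l ^ 2 * k3 ^ 2) by (apply Rmult_le_pos; apply pow2_ge_0); lra. }
lra.
Qed.

(** * Real and imaginary growth along the circle *)

(** [rho] is the smaller root of [r x^2 - (r - 1) x + 1], that is, of the saddle equation
    [r / (1 + x) = 1 / (1 - x) + 1 / x]. The bound on [r] makes the discriminant positive,
    [3 + 2 sqrt 2] being the larger root of [r^2 - 6 r + 1]. *)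
Lemma saddle_point_facts (r rho : R) :
  r > 3 + 2 * sqrt 2 ->
  rho = (r - 1 - sqrt (r ^ 2 - 6 * r + 1)) / (2 * r) ->
  0 < rho /\ rho ^ 2 + 2 * rho < 1 /\ r = (1 + rho) / (rho * (1 - rho)).
Proof.
intros hr hrho.
pose proof (sqrt_lt_R0 2 ltac:(lra)) as Hq; pose proof (sqrt_sqrt 2 ltac:(lra)) as Hqq.
assert (Hdisc : 0 < r ^ 2 - 6 * r + 1) by nra.
set (S := sqrt (r ^ 2 - 6 * r + 1)) in hrho.
assert (HS : 0 < S) by (apply sqrt_lt_R0, Hdisc).
assert (HSS : S * S = r ^ 2 - 6 * r + 1) by (apply sqrt_sqrt; lra).
assert (HSr : S < r - 1) by nra.
assert (Hrho : 0 < rho) by (rewrite hrho; apply Rdiv_lt_0_compat; lra).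
assert (H2r : 2 * r * rho = r - 1 - S) by (rewrite hrho; field; lra).
assert (Hquad : r * (rho * (1 - rho)) = 1 + rho).
{ assert (4 * r * (r * (rho * (1 - rho)) - (1 + rho)) = 0); [|nra].
  replace (4 * r * (r * (rho * (1 - rho)) - (1 + rho))) with
    (2 * r * (2 * r * rho) - (2 * r * rho) * (2 * r * rho) - 4 * r - 2 * (2 * r * rho)) by ring.
  rewrite H2r; nra. }
assert (H1 : rho < 1) by nra.
(* The product of the two roots is [1 / r], and [rho] is the smaller one. *)
assert (Hsmall : r * rho ^ 2 < 1).
{ assert (4 * r * (r * rho ^ 2) < 4 * r * 1); [|nra].
  replace (4 * r * (r * rho ^ 2)) with ((2 * r * rho) * (2 * r * rho)) by ring.
  rewrite H2r; nra. }
split; [exact Hrho | split].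
(* By the quadratic, [rho (1 + rho) = r rho^2 (1 - rho)], and [r rho^2 < 1]. *)
- assert (rho * (1 + rho) < 1 - rho); [|lra].
  rewrite <- Hquad; nra.
- rewrite <- Hquad; field; lra.
Qed.

(* [abs2 q t] and [arg q t] are the squared modulus and the argument of
   [1 + q exp (i t)]. *)
Definition abs2 (q t : R) : R := 1 + 2 * q * cos t + q ^ 2.
Definition arg (q t : R) : R := atan (q * sin t / (1 + q * cos t)).

Lemma one_plus_cos_pos (q t : R) : -1 < q < 1 -> 0 < 1 + q * cos t.
Proof. intros Hq; pose proof (COS_bound t); destruct (Rle_dec 0 (cos t)); nra. Qed.

Lemma abs2_sum (q t : R) : abs2 q t = (1 + q * cos t) ^ 2 + (q * sin t) ^ 2.
Proof.
unfold abs2; pose proof (sin2_cos2 t) as H; unfold Rsqr in H.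
replace (q ^ 2) with (q ^ 2 * (sin t * sin t + cos t * cos t)) by (rewrite H; ring); ring.
Qed.

Lemma abs2_pos (q t : R) : -1 < q < 1 -> 0 < abs2 q t.
Proof.
intros Hq; rewrite abs2_sum; pose proof (one_plus_cos_pos q t Hq).
pose proof (pow2_ge_0 (q * sin t)); nra.
Qed.

(** The value is the real part of [z / (1 + z)] at [z = q exp (i t)]. *)
Lemma is_derive_arg (q t : R) :
  -1 < q < 1 -> is_derive (arg q) t ((q * cos t + q ^ 2) / abs2 q t).
Proof.
intros Hq; pose proof (one_plus_cos_pos q t Hq) as Hc; pose proof (abs2_pos q t Hq) as Ha.
rewrite abs2_sum in *; unfold arg; auto_derive; [lra |].
pose proof (sin2_cos2 t) as H; unfold Rsqr in H.
replace (q * cos t + q ^ 2) with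
  (q * cos t * (1 + q * cos t) + (q * sin t) ^ 2).
- field; repeat split; try lra; nra.
- transitivity (q * cos t + q ^ 2 * (sin t * sin t + cos t * cos t)); [ring | rewrite H; ring].
Qed.

Lemma arg_opp (q t : R) : arg q (- t) = - arg q t.
Proof.
unfold arg; rewrite sin_neg, cos_neg, <- atan_opp; f_equal; unfold Rdiv; ring.
Qed.

(* [re_growth] and [im_growth] are the real and imaginary parts of
   [f (rho e^(i t)) - f rho]. *)
Definition re_growth (r rho t : R) : R :=
  r / 2 * (ln (abs2 rho t) - ln (abs2 rho 0))
  + (ln (abs2 (- rho) t) - ln (abs2 (- rho) 0)) / 2.

Definition im_growth (r rho t : R) : R := r * arg rho t + arg (- rho) t - t.

Lemma continuous_re_growth (r rho t : R) : 0 < rho < 1 -> continuous (re_growth r rho) t.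
Proof.
intros Hp; apply (ex_derive_continuous (re_growth r rho)).
pose proof (abs2_pos rho t ltac:(lra)) as H1; pose proof (abs2_pos (- rho) t ltac:(lra)) as H2.
unfold re_growth, abs2 in *; auto_derive; repeat split; lra.
Qed.

Lemma is_derive_im_growth (r rho t : R) :
  0 < rho < 1 ->
  is_derive (im_growth r rho) t
    (r * ((rho * cos t + rho ^ 2) / abs2 rho t)
     + ((- rho * cos t + (- rho) ^ 2) / abs2 (- rho) t) - 1).
Proof.
intros Hp.
apply (is_derive_minus (fun t => r * arg rho t + arg (- rho) t) (fun t => t));
  [|apply (is_derive_id (K := R_AbsRing))].
apply (is_derive_plus (fun t => r * arg rho t)); [apply (is_derive_scal (arg rho)) |];
  apply is_derive_arg; lra.
Qed.

Lemma continuous_im_growth (r rho t : R) : 0 < rho < 1 -> continuous (im_growth r rho) t.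
Proof.
intros Hp; apply (ex_derive_continuous (im_growth r rho)); eexists.
apply is_derive_im_growth, Hp.
Qed.

Lemma im_growth_opp (r rho t : R) : im_growth r rho (- t) = - im_growth r rho t.
Proof. unfold im_growth; rewrite !arg_opp; ring. Qed.

Lemma im_growth_0 (r rho : R) : im_growth r rho 0 = 0.
Proof. pose proof (im_growth_opp r rho 0) as H; rewrite Ropp_0 in H; lra. Qed.

(** * Uniform bounds on the growth under the saddle equation *)

Section SaddlePoint.

Variables r rho : R.
Hypothesis rho_gt0 : 0 < rho.
Hypothesis rho_small : rho ^ 2 + 2 * rho < 1.
Hypothesis r_eq : r = (1 + rho) / (rho * (1 - rho)).

Let M := rho ^ 2 * (- (r / (1 + rho) ^ 2) - 1 / (1 - rho) ^ 2 + 1 / rho ^ 2).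

Lemma rho_lt1 : rho < 1.
Proof. nra. Qed.

Lemma rho_lt_sqrt2 : rho < sqrt 2 - 1.
Proof.
pose proof (sqrt_lt_R0 2 ltac:(lra)); pose proof (sqrt_sqrt 2 ltac:(lra)); nra.
Qed.

(** With [r] eliminated, the sign of [M] is exactly the constraint [rho_small]. *)
Lemma M_eq : M = (1 - 2 * rho - rho ^ 2) / ((1 - rho) ^ 2 * (1 + rho)).
Proof. pose proof rho_lt1; unfold M; rewrite r_eq; field; lra. Qed.

Lemma M_gt0 : 0 < M.
Proof.
pose proof rho_lt1; rewrite M_eq; apply Rdiv_lt_0_compat; [lra |].
apply Rmult_lt_0_compat; [apply pow_lt |]; lra.
Qed.

Lemma M_le1 : M <= 1.
Proof.
pose proof rho_lt1; rewrite M_eq; apply Rle_div_l; [|nra].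
apply Rmult_lt_0_compat; [apply pow_lt |]; lra.
Qed.

Lemma ln_abs2_plus (t : R) :
  ln (abs2 rho t) - ln (abs2 rho 0) = ln (1 - 2 * rho * (1 - cos t) / (1 + rho) ^ 2).
Proof.
pose proof rho_lt1; rewrite <- ln_div by (apply abs2_pos; lra).
f_equal; unfold abs2; rewrite cos_0; field; split; nra.
Qed.

Lemma ln_abs2_minus (t : R) :
  ln (abs2 (- rho) t) - ln (abs2 (- rho) 0) = ln (1 + 2 * rho * (1 - cos t) / (1 - rho) ^ 2).
Proof.
pose proof rho_lt1; rewrite <- ln_div by (apply abs2_pos; lra).
f_equal; unfold abs2; rewrite cos_0; field; split; nra.
Qed.

(** The extreme [u = 2] is the point [z = - rho] of the circle. The bound keeps the logarithm's
    argument positive and gives the worst denominator for the remainder in [ln_1m_ge]. *)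
Lemma abs2_ratio_bound (u : R) :
  u <= 2 -> (1 - rho) ^ 2 / (1 + rho) ^ 2 <= 1 - 2 * rho * u / (1 + rho) ^ 2.
Proof.
intros Hu; assert (0 < (1 + rho) ^ 2) by (apply pow_lt; lra).
replace (1 - 2 * rho * u / (1 + rho) ^ 2) with (((1 + rho) ^ 2 - 2 * rho * u) / (1 + rho) ^ 2)
  by (field; lra).
apply Rmult_le_compat_r; [apply Rlt_le, Rinv_0_lt_compat; lra | nra].
Qed.

(** As functions of [u], both logarithms lie below their tangents at 0, so no remainder appears on
    this side; the two slopes add up to [- M]. *)
Lemma re_growth_le (t : R) : re_growth r rho t <= - (M * (1 - cos t)).
Proof.
pose proof rho_lt1; pose proof (COS_bound t) as Hc.
unfold re_growth; rewrite ln_abs2_plus, ln_abs2_minus.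
set (u := 1 - cos t); assert (Hu : 0 <= u <= 2) by (unfold u; lra).
assert (Hx : 0 < (1 - rho) ^ 2 / (1 + rho) ^ 2) by (apply Rdiv_lt_0_compat; apply pow_lt; lra).
pose proof (abs2_ratio_bound u ltac:(lra)) as Hx'.
assert (Hy : 0 <= 2 * rho * u / (1 - rho) ^ 2).
{ apply Rdiv_le_0_compat; [nra | apply pow_lt; lra]. }
pose proof (ln_1p_le (- (2 * rho * u / (1 + rho) ^ 2)) ltac:(lra)) as L1.
pose proof (ln_1p_le (2 * rho * u / (1 - rho) ^ 2) ltac:(lra)) as L2.
assert (Hr : 0 < r).
{ rewrite r_eq; apply Rdiv_lt_0_compat; [lra | apply Rmult_lt_0_compat; lra]. }
replace (- (M * u)) with
  (r / 2 * - (2 * rho * u / (1 + rho) ^ 2) + (2 * rho * u / (1 - rho) ^ 2) / 2)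
  by (rewrite M_eq, r_eq; field; lra).
apply Rplus_le_compat; [apply Rmult_le_compat_l; [lra | exact L1] | lra].
Qed.

(** The sum of the quadratic remainders of [ln_1m_ge] and [ln_1p_ge] as a coefficient of [u^2], with
    [1 - x] replaced by its minimum [(1 - rho)^2 / (1 + rho)^2] and [r] eliminated. *)
Let D := rho * (1 + rho ^ 2) / ((1 + rho) * (1 - rho) ^ 4).

Lemma D_bounds : 0 < D <= (3 + 2 * sqrt 2) / 2.
Proof.
pose proof rho_lt1; pose proof rho_lt_sqrt2 as Hs; pose proof (pow2_ge_0 rho).
pose proof (sqrt_lt_R0 2 ltac:(lra)) as Hq; pose proof (sqrt_sqrt 2 ltac:(lra)) as Hqq.
set (q := sqrt 2) in *.
assert (Hq2 : q < 2) by nra.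
assert (Hden : 0 < (1 + rho) * (1 - rho) ^ 4)
  by (apply Rmult_lt_0_compat; [| apply pow_lt]; lra).
split.
- apply Rdiv_lt_0_compat; [apply Rmult_lt_0_compat; lra | exact Hden].
- apply Rle_div_l; [exact Hden |].
  assert (Hcube : (2 - q) ^ 3 <= (1 - rho) ^ 3) by (apply pow_incr; lra).
  assert (Hc0 : 0 <= (2 - q) ^ 3) by (apply pow_le; lra).
  assert (Hsq : rho ^ 2 <= (q - 1) ^ 2) by (apply pow_incr; lra).
  assert (Hd : (1 - (q - 1) ^ 2) * (2 - q) ^ 3 <= (1 - rho ^ 2) * (1 - rho) ^ 3)
    by (apply Rmult_le_compat; nra || lra).
  assert (Hn : rho * (1 + rho ^ 2) <= (q - 1) * (1 + (q - 1) ^ 2))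
    by (apply Rmult_le_compat; nra).
  replace ((q - 1) * (1 + (q - 1) ^ 2)) with
    ((3 + 2 * q) / 2 * ((1 - (q - 1) ^ 2) * (2 - q) ^ 3)) in Hn.
  + apply Rle_trans with (1 := Hn).
    replace ((1 + rho) * (1 - rho) ^ 4) with ((1 - rho ^ 2) * (1 - rho) ^ 3) by ring.
    apply Rmult_le_compat_l; [lra | exact Hd].
  + assert (H3 : q ^ 2 = 2) by (simpl; lra).
    replace (1 - (q - 1) ^ 2) with (2 * q - q ^ 2) by ring.
    replace ((2 - q) ^ 3) with (8 - 12 * q + 6 * q ^ 2 - q ^ 2 * q) by ring.
    replace ((q - 1) ^ 2) with (q ^ 2 - 2 * q + 1) by ring.
    rewrite H3; nra.
Qed.

Lemma re_growth_ge (t : R) :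
  - (M * (1 - cos t)) - D * (1 - cos t) ^ 2 <= re_growth r rho t.
Proof.
pose proof rho_lt1; pose proof (COS_bound t) as Hc.
unfold re_growth; rewrite ln_abs2_plus, ln_abs2_minus.
set (u := 1 - cos t); assert (Hu : 0 <= u <= 2) by (unfold u; lra).
assert (H1p : 0 < (1 + rho) ^ 2) by (apply pow_lt; lra).
assert (H1m : 0 < (1 - rho) ^ 2) by (apply pow_lt; lra).
pose proof (abs2_ratio_bound u ltac:(lra)) as Hx.
assert (Hk : 0 < (1 - rho) ^ 2 / (1 + rho) ^ 2) by (apply Rdiv_lt_0_compat; lra).
assert (Hx0 : 0 <= 2 * rho * u / (1 + rho) ^ 2) by (apply Rdiv_le_0_compat; nra).
assert (Hy : 0 <= 2 * rho * u / (1 - rho) ^ 2) by (apply Rdiv_le_0_compat; nra).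
pose proof (ln_1m_ge (2 * rho * u / (1 + rho) ^ 2) ltac:(lra)) as L1.
pose proof (ln_1p_ge (2 * rho * u / (1 - rho) ^ 2) Hy) as L2.
assert (Hr : 0 < r).
{ rewrite r_eq; apply Rdiv_lt_0_compat; [lra | apply Rmult_lt_0_compat; lra]. }
assert (E : - (M * u) - D * u ^ 2 =
  r / 2 * (- (2 * rho * u / (1 + rho) ^ 2)
           - (2 * rho * u / (1 + rho) ^ 2) ^ 2 / (2 * ((1 - rho) ^ 2 / (1 + rho) ^ 2)))
  + (2 * rho * u / (1 - rho) ^ 2 - (2 * rho * u / (1 - rho) ^ 2) ^ 2 / 2) / 2)
  by (rewrite M_eq; unfold D; rewrite r_eq; field; lra).
rewrite E.
apply Rplus_le_compat; [|lra].
apply Rmult_le_compat_l; [lra |].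
apply Rle_trans with (2 := L1).
apply Rplus_le_compat_l, Ropp_le_contravar, Rmult_le_compat_l; [apply pow2_ge_0 |].
apply Rinv_le_contravar; lra.
Qed.

Lemma re_growth_gaussian_le (t : R) :
  - PI <= t <= PI -> re_growth r rho t <= - (2 * M * t ^ 2 / PI ^ 2).
Proof.
intros Ht; pose proof M_gt0; pose proof PI_RGT_0.
apply Rle_trans with (1 := re_growth_le t), Ropp_le_contravar.
replace (2 * M * t ^ 2 / PI ^ 2) with (M * (2 * t ^ 2 / PI ^ 2)) by (field; lra).
apply Rmult_le_compat_l; [lra | apply one_minus_cos_ge_jordan, Ht].
Qed.

(** Replacing [u] by [t^2 / 2] can only help on the lower side, which loses [D u^2 <= D t^4 / 4].
    The upper side loses at most [M t^4 / 24], and [M <= 1] leaves this well below the stated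
    constant. *)
Lemma re_growth_quartic (t : R) :
  Rabs (re_growth r rho t + M * t ^ 2 / 2) <= (3 + 2 * sqrt 2) / 8 * t ^ 4.
Proof.
pose proof M_gt0 as HM; pose proof M_le1 as HM1; pose proof D_bounds as HD.
pose proof (re_growth_le t) as Hle; pose proof (re_growth_ge t) as Hge.
pose proof (one_minus_cos_le t) as Hu; pose proof (one_minus_cos_ge t) as Hu'.
assert (Hu0 : 0 <= 1 - cos t) by (pose proof (COS_bound t); lra).
set (u := 1 - cos t) in *.
assert (Ht4 : 0 <= t ^ 4) by (replace (t ^ 4) with ((t ^ 2) ^ 2) by ring; apply pow2_ge_0).
pose proof (sqrt_lt_R0 2 ltac:(lra)) as Hq.
apply Rabs_le; split.
- assert (Huu : u ^ 2 <= t ^ 4 / 4).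
  { replace (t ^ 4 / 4) with ((t ^ 2 / 2) ^ 2) by field; apply pow_incr; lra. }
  assert (D * u ^ 2 <= (3 + 2 * sqrt 2) / 2 * (t ^ 4 / 4)).
  { apply Rmult_le_compat; [lra | apply pow2_ge_0 | lra | exact Huu]. }
  assert (0 <= M * (t ^ 2 / 2 - u)) by (apply Rmult_le_pos; lra).
  lra.
- assert (M * (t ^ 2 / 2 - u) <= 1 * (t ^ 4 / 24)) by (apply Rmult_le_compat; lra).
  assert (0 <= sqrt 2 * t ^ 4) by (apply Rmult_le_pos; lra).
  lra.
Qed.

Let K (t : R) := / abs2 rho t - rho * (1 + rho) / ((1 - rho) * abs2 (- rho) t).

(** The saddle equation makes the derivative vanish at [t = 0]. Being a rational function of
    [cos t], it then has the factor [1 - cos t], and this makes [im_growth] cubic. *)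
Lemma is_derive_im_growth_saddle (t : R) :
  is_derive (im_growth r rho) t (- ((1 - cos t) * K t)).
Proof.
pose proof rho_lt1.
apply (is_derive_eq _ _ _ _) with (2 := is_derive_im_growth r rho t ltac:(lra)).
pose proof (abs2_pos rho t ltac:(lra)) as H1; pose proof (abs2_pos (- rho) t ltac:(lra)) as H2.
unfold K, abs2 in *; rewrite r_eq; field; lra.
Qed.

Lemma K_bound (t : R) : Rabs (K t) <= 1 + sqrt 2.
Proof.
pose proof rho_lt1; pose proof rho_lt_sqrt2 as Hs; pose proof (pow2_ge_0 rho).
pose proof (sqrt_lt_R0 2 ltac:(lra)) as Hq; pose proof (sqrt_sqrt 2 ltac:(lra)) as Hqq.
set (q := sqrt 2) in *; assert (Hq2 : q < 2) by nra.
pose proof (COS_bound t) as Hc.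
assert (H1m : 0 < (1 - rho) ^ 2) by (apply pow_lt; lra).
assert (HA : (1 - rho) ^ 2 <= abs2 rho t <= (1 + rho) ^ 2) by (unfold abs2; split; nra).
assert (HB : (1 - rho) ^ 2 <= abs2 (- rho) t <= (1 + rho) ^ 2) by (unfold abs2; split; nra).
set (A := abs2 rho t) in *; set (B := abs2 (- rho) t) in *.
assert (Hcoef : 0 <= rho * (1 + rho) / (1 - rho)) by (apply Rdiv_le_0_compat; nra).
assert (EK : K t = / A - rho * (1 + rho) / (1 - rho) * / B)
  by (unfold K; fold A B; field; lra).
assert (iA1 : / A <= / (1 - rho) ^ 2) by (apply Rinv_le_contravar; lra).
assert (iA2 : / 2 <= / A) by (apply Rinv_le_contravar; nra).
assert (iB1 : / B <= / (1 - rho) ^ 2) by (apply Rinv_le_contravar; lra).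
assert (iB2 : / (1 + rho) ^ 2 <= / B) by (apply Rinv_le_contravar; lra).
assert (Hcube : (2 - q) ^ 3 <= (1 - rho) ^ 3) by (apply pow_incr; lra).
rewrite EK; apply Rabs_le; split.
(* Here [/ A >= / 2] because [(1 + rho)^2 < 2], and [(3 + 2 q) / 2 - 1 / 2 = 1 + q]. The number
   [(3 + 2 q) / 2] is [1 / (2 - q)^2]. *)
- assert (HB' : rho * (1 + rho) / (1 - rho) * / B <= (3 + 2 * q) / 2); [|lra].
  apply Rle_trans with (1 := Rmult_le_compat_l _ _ _ Hcoef iB1).
  replace (rho * (1 + rho) / (1 - rho) * / (1 - rho) ^ 2) with (rho * (1 + rho) / (1 - rho) ^ 3)
    by (field; lra).
  apply Rle_div_l; [apply pow_lt; lra |].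
  apply Rle_trans with ((3 + 2 * q) / 2 * (2 - q) ^ 3);
    [|apply Rmult_le_compat_l; lra].
  replace ((3 + 2 * q) / 2 * (2 - q) ^ 3) with ((q - 1) * q).
  + apply Rmult_le_compat; lra.
  + replace ((2 - q) ^ 3) with (8 - 12 * q + 6 * (q * q) - q * q * q) by ring.
    rewrite Hqq; nra.
(* Dropping the negative term would only give [(3 + 2 q) / 2 > 1 + q]. Both terms are therefore
   taken at their common extreme [t = PI] and combined before [rho] is bounded. *)
- assert (HB' : rho * (1 + rho) / (1 - rho) * / (1 + rho) ^ 2
                <= rho * (1 + rho) / (1 - rho) * / B) by (apply Rmult_le_compat_l; lra).
  enough (/ (1 - rho) ^ 2 - rho * (1 + rho) / (1 - rho) * / (1 + rho) ^ 2 <= 1 + q) by lra.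
  replace (/ (1 - rho) ^ 2 - rho * (1 + rho) / (1 - rho) * / (1 + rho) ^ 2) with
    ((1 + rho ^ 2) / ((1 - rho) * (1 - rho ^ 2))) by (field; nra).
  apply Rle_div_l; [apply Rmult_lt_0_compat; nra |].
  assert (Hsq : rho ^ 2 <= (q - 1) ^ 2) by (apply pow_incr; lra).
  assert (Hd : (2 - q) * (1 - (q - 1) ^ 2) <= (1 - rho) * (1 - rho ^ 2))
    by (apply Rmult_le_compat; nra).
  apply Rle_trans with ((1 + q) * ((2 - q) * (1 - (q - 1) ^ 2)));
    [|apply Rmult_le_compat_l; lra].
  replace ((1 + q) * ((2 - q) * (1 - (q - 1) ^ 2))) with (1 + (q - 1) ^ 2); [lra|].
  replace ((q - 1) ^ 2) with (q * q - 2 * q + 1) by ring.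
  rewrite Hqq; nra.
Qed.

(** Integrating [|H'| <= (1 + sqrt 2) t^2 / 2] from 0 bounds [H] on both sides by a cube; the
    squared form avoids absolute values and is all that the cosine needs. *)
Lemma im_growth_cubic (t : R) :
  im_growth r rho t ^ 2 <= ((1 + sqrt 2) / 6) ^ 2 * t ^ 6.
Proof.
revert t; apply even_reflect.
- intros t; rewrite im_growth_opp.
  replace ((- im_growth r rho t) ^ 2) with (im_growth r rho t ^ 2) by ring.
  replace ((- t) ^ 6) with (t ^ 6) by ring; auto.
- intros t Ht; set (k := (1 + sqrt 2) / 6).
  assert (HK : forall x, Rabs ((1 - cos x) * K x) <= 3 * k * x ^ 2).
  { intros x; pose proof (one_minus_cos_le x); pose proof (COS_bound x).
    rewrite Rabs_mult, Rabs_pos_eq by lra.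
    replace (3 * k * x ^ 2) with (x ^ 2 / 2 * (1 + sqrt 2)) by (unfold k; field).
    apply Rmult_le_compat; [lra | apply Rabs_pos | lra | apply K_bound]. }
  assert (H1 : k * 0 ^ 3 - im_growth r rho 0 <= k * t ^ 3 - im_growth r rho t).
  { apply (le_of_derive_ge0 (fun t => k * t ^ 3 - im_growth r rho t)
             (fun t => 3 * k * t ^ 2 - - ((1 - cos t) * K t))); [exact Ht | |].
    - intros x _; apply (is_derive_minus (fun t => k * t ^ 3));
        [auto_derive; [trivial | ring] | apply is_derive_im_growth_saddle].
    - intros x _; pose proof (HK x) as H; apply Rabs_le_between in H; lra. }
  assert (H2 : k * 0 ^ 3 + im_growth r rho 0 <= k * t ^ 3 + im_growth r rho t).
  { apply (le_of_derive_ge0 (fun t => k * t ^ 3 + im_growth r rho t)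
             (fun t => 3 * k * t ^ 2 + - ((1 - cos t) * K t))); [exact Ht | |].
    - intros x _; apply (is_derive_plus (fun t => k * t ^ 3));
        [auto_derive; [trivial | ring] | apply is_derive_im_growth_saddle].
    - intros x _; pose proof (HK x) as H; apply Rabs_le_between in H; lra. }
  rewrite im_growth_0 in H1, H2.
  replace (k ^ 2 * t ^ 6) with ((k * t ^ 3) ^ 2) by ring.
  nra.
Qed.

End SaddlePoint.

(** * The complex integral *)

(* [C_derive] is defined as a limit along the horizontal line through the point. *)
Lemma C_derive_real (F : C -> C) (g : R -> R) (x l : R) :
  locally x (fun t => F (RtoC t) = RtoC (g t)) -> is_derive g x l ->
  C_derive F (RtoC x) = RtoC l.
Proof.
intros Hloc Hd.
assert (Hx : F (RtoC x) = RtoC (g x)) by apply (locally_singleton _ _ Hloc).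
assert (Hq : forall t, t <> x -> F (RtoC t) = RtoC (g t) ->
  ((F (t, 0) - F (RtoC x)) / ((t, 0) - RtoC x))%C = RtoC ((g t - g x) / (t - x))).
{ intros t Ht HF; change (t, 0) with (RtoC t); rewrite HF, Hx.
  rewrite <- !RtoC_minus, <- RtoC_div; [reflexivity | lra]. }
assert (Hl : is_lim (fun t => (g t - g x) / (t - x)) x l).
{ apply is_lim_spec; intros eps; apply is_derive_Reals in Hd.
  destruct (Hd eps (cond_pos eps)) as [d Hdel].
  exists d; intros t Hball Ht.
  specialize (Hdel (t - x) ltac:(lra) Hball).
  rewrite Rplus_minus in Hdel; exact Hdel. }
destruct Hloc as [d Hloc].
unfold C_derive, C_lim; change (fst (RtoC x)) with x; change (snd (RtoC x)) with 0.
apply f_equal2.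
- transitivity (real (Lim (fun t => (g t - g x) / (t - x)) x));
    [| rewrite (is_lim_unique _ _ _ Hl); reflexivity].
  apply f_equal, Lim_ext_loc; exists d; intros t Hball Ht.
  rewrite (Hq t Ht (Hloc t Hball)); reflexivity.
- transitivity (real (Lim (fun _ => 0) x)); [| rewrite Lim_const; reflexivity].
  apply f_equal, Lim_ext_loc; exists d; intros t Hball Ht.
  rewrite (Hq t Ht (Hloc t Hball)); reflexivity.
Qed.

Lemma Log_pos (x : R) : 0 < x -> Log (RtoC x) = RtoC (ln x).
Proof.
intros Hx; unfold Log, Arg; rewrite Cmod_R, (Rabs_pos_eq x) by lra.
cbn [Re Im fst snd RtoC].
destruct (Rle_dec 0 0) as [_|H]; [|lra].
replace (x / x) with 1 by (field; lra); rewrite acos_1; reflexivity.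
Qed.

Lemma f_complex_real (r x : R) :
  0 < x < 1 -> f_complex r (RtoC x) = RtoC (r * ln (1 + x) + ln (1 - x) - ln x).
Proof.
intros Hx; unfold f_complex; rewrite <- RtoC_plus, <- RtoC_minus, !Log_pos by lra.
rewrite <- RtoC_mult, <- RtoC_plus, <- RtoC_minus; reflexivity.
Qed.

Lemma C_derive_f_complex (r x : R) :
  0 < x < 1 -> C_derive (f_complex r) (RtoC x) = RtoC (r / (1 + x) - 1 / (1 - x) - 1 / x).
Proof.
intros Hx; apply (C_derive_real _ (fun x => r * ln (1 + x) + ln (1 - x) - ln x)).
- apply (filter_imp (fun t => 0 < t < 1)); [apply f_complex_real |].
  apply (open_and (fun t => 0 < t) (fun t => t < 1)); [apply open_gt | apply open_lt | exact Hx].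
- auto_derive; [repeat split; lra | field; lra].
Qed.

(** The formula for the first derivative holds on the open interval [(0, 1)], hence near [x], so it
    can be differentiated in turn. *)
Lemma C_derive2_f_complex (r x : R) :
  0 < x < 1 ->
  C_derive (C_derive (f_complex r)) (RtoC x)
  = RtoC (- (r / (1 + x) ^ 2) - 1 / (1 - x) ^ 2 + 1 / x ^ 2).
Proof.
intros Hx; apply (C_derive_real _ (fun x => r / (1 + x) - 1 / (1 - x) - 1 / x)).
- apply (filter_imp (fun t => 0 < t < 1)); [apply C_derive_f_complex |].
  apply (open_and (fun t => 0 < t) (fun t => t < 1)); [apply open_gt | apply open_lt | exact Hx].
- auto_derive; [repeat split; lra | field; lra].
Qed.

(** * From the complex integrand to a real integral *)

(** For [|q| < 1] the number [1 + q exp (i t)] lies in the right half-plane, where [atan] of the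
    slope is the principal argument; its polar form reduces the claim to [Log_polar]. *)
Lemma Log_one_plus_polar (q t : R) :
  -1 < q < 1 -> Log (1 + polar q t) = (ln (abs2 q t) / 2, arg q t).
Proof.
intros Hq; pose proof (one_plus_cos_pos q t Hq) as Ha; pose proof (abs2_pos q t Hq) as Hm.
pose proof (sqrt_lt_R0 _ Hm) as Hs; pose proof (sqrt_sqrt _ (Rlt_le _ _ Hm)) as Hss.
replace (1 + polar q t)%C with (polar (sqrt (abs2 q t)) (arg q t)).
- rewrite Log_polar; [| exact Hs | pose proof (atan_bound (q * sin t / (1 + q * cos t)));
                        unfold arg; lra].
  unfold RtoC, Ci, Cplus, Cmult; cbn [fst snd]; f_equal; [|ring].
  rewrite <- Hss at 2; rewrite ln_mult by exact Hs; field.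
- rewrite !polarE; unfold arg; rewrite cos_atan, sin_atan.
  set (a := 1 + q * cos t) in *; set (b := q * sin t).
  assert (Hn : sqrt (1 + (b / a)²) = sqrt (abs2 q t) / a).
  { apply sqrt_lem_1.
    - pose proof (Rle_0_sqr (b / a)); lra.
    - apply Rdiv_le_0_compat; lra.
    - replace (sqrt (abs2 q t) / a * (sqrt (abs2 q t) / a)) with
        (sqrt (abs2 q t) * sqrt (abs2 q t) / (a * a)) by (field; lra).
      rewrite Hss, abs2_sum; fold a b; unfold Rsqr; field; lra. }
  rewrite Hn; unfold Cplus, RtoC; cbn [fst snd]; fold b; f_equal.
  + transitivity a; [field; lra | reflexivity].
  + rewrite Rplus_0_l; field; lra.
Qed.

Lemma f_circle_0 (r rho : R) :
  0 < rho < 1 -> f_circle r rho 0 = RtoC (r * ln (1 + rho) + ln (1 - rho) - ln rho).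
Proof.
intros Hp; unfold f_circle.
replace (polar rho 0) with (RtoC rho)
  by (rewrite polarE, cos_0, sin_0; unfold RtoC; f_equal; ring).
rewrite <- RtoC_plus, <- RtoC_minus, !Log_pos by lra.
rewrite !RtoC_minus, RtoC_plus, RtoC_mult; ring.
Qed.

Lemma f_circle_growth (r rho t : R) :
  0 < rho < 1 ->
  f_circle r rho t = (f_circle r rho 0 + (re_growth r rho t, im_growth r rho t))%C.
Proof.
assert (Hv : forall t, 0 < rho < 1 -> f_circle r rho t =
  (r * (ln (abs2 rho t) / 2) + ln (abs2 (- rho) t) / 2 - ln rho, im_growth r rho t)).
{ intros t' Hp; unfold f_circle.
  (* A negative radius lets the formula for [Log (1 + z)] serve for both logarithms. *)
  replace (1 - polar rho t')%C with (1 + polar (- rho) t')%C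
    by (rewrite !polarE; unfold Cminus, Cplus, Copp, RtoC; cbn [fst snd]; f_equal; ring).
  rewrite !Log_one_plus_polar by lra.
  unfold Cminus, Cplus, Cmult, Copp, RtoC, Ci, im_growth; cbn [fst snd]; f_equal; ring. }
intros Hp; rewrite !Hv by exact Hp; rewrite im_growth_0.
unfold Cplus, re_growth; cbn [fst snd]; f_equal; [field | ring].
Qed.

Lemma is_RInt_odd (f : R -> R) (a l : R) :
  (forall t, f (- t) = - f t) -> is_RInt f (- a) a l -> l = 0.
Proof.
intros Hodd Hl.
assert (Hl' : is_RInt f (- a) a (- l)).
{ apply (is_RInt_swap (V := R_NormedModule)).
  apply (is_RInt_ext (fun t => opp (f (- t)))).
  - intros t _; rewrite Hodd; apply Ropp_involutive.
  - apply (is_RInt_comp_opp (V := R_NormedModule)); rewrite Ropp_involutive; exact Hl. }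
apply (is_RInt_unique (V := R_CompleteNormedModule)) in Hl, Hl'.
rewrite Hl in Hl'; lra.
Qed.

Lemma Iint_eq (r rho lambda : R) :
  0 < rho < 1 ->
  Iint r rho lambda =
  (Cexp (RtoC lambda * f_circle r rho 0)
   * RtoC (RInt (fun t => exp (lambda * re_growth r rho t) * cos (lambda * im_growth r rho t))
             (- PI) PI / (2 * PI))%R)%C.
Proof.
intros Hp; pose proof PI_RGT_0 as Hpi.
set (g := re_growth r rho); set (h := im_growth r rho).
set (f0 := r * ln (1 + rho) + ln (1 - rho) - ln rho).
set (c := exp (lambda * f0) / (2 * PI)).
set (fc := fun t => exp (lambda * g t) * cos (lambda * h t)).
set (fs := fun t => exp (lambda * g t) * sin (lambda * h t)).
assert (Hcont : forall (k : R -> R), (forall y, continuous k y) ->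
  ex_RInt (fun t => exp (lambda * g t) * k (lambda * h t)) (- PI) PI).
{ intros k Hk; apply (ex_RInt_continuous (V := R_CompleteNormedModule)); intros t _.
  apply (continuous_mult (fun t => exp (lambda * g t)) (fun t => k (lambda * h t))).
  - apply (continuous_comp (fun t => lambda * g t) exp);
      [apply (continuous_scal_r (V := R_NormedModule) lambda g), continuous_re_growth, Hp |].
    apply (ex_derive_continuous exp); auto_derive; trivial.
  - apply (continuous_comp (fun t => lambda * h t) k); [|apply Hk].
    apply (continuous_scal_r (V := R_NormedModule) lambda h), continuous_im_growth, Hp. }
assert (Hc : is_RInt fc (- PI) PI (RInt fc (- PI) PI)).
{ apply (RInt_correct (V := R_CompleteNormedModule)), (Hcont cos).
  intros y; apply (ex_derive_continuous cos); auto_derive; trivial. }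
assert (Hs : is_RInt fs (- PI) PI 0).
{ assert (Hs : is_RInt fs (- PI) PI (RInt fs (- PI) PI)).
  { apply (RInt_correct (V := R_CompleteNormedModule)), (Hcont sin).
    intros y; apply (ex_derive_continuous sin); auto_derive; trivial. }
  rewrite (is_RInt_odd fs PI (RInt fs (- PI) PI)) in Hs; [exact Hs | | exact Hs].
  intros t; unfold fs, g, h; rewrite im_growth_opp.
  replace (lambda * - im_growth r rho t) with (- (lambda * im_growth r rho t)) by ring.
  rewrite sin_neg; unfold re_growth, abs2; rewrite cos_neg; ring. }
rewrite f_circle_0 by exact Hp; fold f0.
transitivity (c * RInt fc (- PI) PI, c * 0).
2:{ unfold Cexp, Cmult, RtoC, c; cbn [fst snd Re Im].
    replace (lambda * 0 + 0 * f0) with 0 by ring; rewrite cos_0, sin_0.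
    replace (lambda * f0 - 0 * 0) with (lambda * f0) by ring.
    f_equal; field; lra. }
unfold Iint; apply (is_RInt_unique (V := C_R_CompleteNormedModule)).
apply (is_RInt_ext (V := C_R_NormedModule) (fun t => (c * fc t, c * fs t))).
{ intros t _; rewrite f_circle_growth, f_circle_0 by exact Hp; fold f0 g h.
  rewrite RtoC_mult; unfold Cdiv.
  replace (/ (2 * PI))%C with (RtoC (/ (2 * PI))).
  2:{ rewrite RtoC_inv, RtoC_mult; [reflexivity | lra]. }
    unfold Cexp, Cmult, Cplus, RtoC, c, fc, fs; cbn [fst snd Re Im].
  replace (lambda * (f0 + g t) - 0 * (0 + h t)) with (lambda * f0 + lambda * g t) by ring.
  replace (lambda * (0 + h t) + 0 * (f0 + g t)) with (lambda * h t) by ring.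
  rewrite exp_plus; f_equal; field; lra. }
apply (is_RInt_fct_extend_pair (U := R_NormedModule) (V := R_NormedModule)); cbn [fst snd];
  apply (is_RInt_scal (V := R_NormedModule)); assumption.
Qed.

(** The first two conjuncts certify that the explicit real formulas for [f(rho)] and [M] agree with
    the complex [f_circle] and with the second complex derivative of [f_complex]. *)
Theorem theorem4 (r rho M : R)
  (hr : r > 3 + 2 * sqrt 2)
  (hrho : rho = (r - 1 - sqrt (r ^ 2 - 6 * r + 1)) / (2 * r))
  (hM : M = rho ^ 2 * (- (r / (1 + rho) ^ 2) - 1 / (1 - rho) ^ 2 + 1 / rho ^ 2)) :
  f_circle r rho 0 = RtoC (r * ln (1 + rho) + ln (1 - rho) - ln rho) /\
  RtoC M = (RtoC rho ^ 2 * C_derive (C_derive (f_complex r)) (RtoC rho))%C /\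
  M > 0 /\
  forall lambda : R, lambda > 0 ->
    Cmod (RtoC (sqrt (2 * PI * lambda * M)) / Cexp (RtoC lambda * f_circle r rho 0)
          * Iint r rho lambda - 1)%C
    <= 3 * (3 + 2 * sqrt 2) * PI ^ 5 / (256 * lambda * M ^ 2)
       + 5 * (3 + 2 * sqrt 2) / (24 * lambda * M ^ 3)
       + sqrt 2 * exp (- (lambda * M * (PI ^ 2 / 2)))
         / (Rpower PI (3 / 2) * sqrt (lambda * M)).
Proof.
destruct (saddle_point_facts r rho hr hrho) as [Hp0 [Hp2 Hr]].
pose proof (rho_lt1 rho Hp2) as Hp1; pose proof PI_RGT_0 as Hpi.
pose proof (M_gt0 r rho Hp0 Hp2 Hr) as HM; rewrite <- hM in HM.
split; [apply f_circle_0; lra | split; [| split; [exact HM |]]].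
- rewrite C_derive2_f_complex by lra.
  rewrite hM, RtoC_mult, RtoC_pow; reflexivity.
- intros lambda Hl; rewrite Iint_eq by lra.
  set (J := RInt _ _ _).
  (* The factor [exp (lambda f(rho))] cancels, which leaves a real number; the cancellation needs
     [Cexp] at the real point [lambda f(rho)] to be nonzero. *)
  replace (_ - 1)%C with (RtoC (sqrt (2 * PI * lambda * M) / (2 * PI) * J - 1)).
  2:{ rewrite RtoC_minus, RtoC_mult, !RtoC_div by lra.
      field; split; [intros H; apply RtoC_inj in H; lra |].
      rewrite f_circle_0 by lra; unfold Cexp, Cmult, RtoC; cbn [fst snd Re Im].
      replace (lambda * 0 + 0 * (r * ln (1 + rho) + ln (1 - rho) - ln rho)) with 0 by ring.
      rewrite cos_0; intros H; injection H as H _.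
      pose proof (exp_pos (lambda * (r * ln (1 + rho) + ln (1 - rho) - ln rho) - 0 * 0)); lra. }
  rewrite Cmod_R.
  pose proof (sqrt_lt_R0 2 ltac:(lra)) as Hq; pose proof (sqrt_sqrt 2 ltac:(lra)) as Hqq.
  eapply Rle_trans.
  + apply (laplace_bound (re_growth r rho) (im_growth r rho) lambda M
             ((3 + 2 * sqrt 2) / 8) ((1 + sqrt 2) / 6)); try assumption; try lra.
    * intros t; apply continuous_re_growth; lra.
    * intros t; apply continuous_im_growth; lra.
    * intros t Ht; rewrite hM; apply re_growth_gaussian_le; assumption.
    * intros t _; rewrite hM; apply re_growth_quartic; assumption.
    * intros t; apply im_growth_cubic; assumption.
  (* [PI^(3/2)] becomes [PI * sqrt PI], and [15 k3^2 / 2] becomes [5 (3 + 2 sqrt 2) / 24]. *)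
  + replace (3 / 2) with (1 + / 2) by field.
    rewrite Rpower_plus, Rpower_1, Rpower_sqrt by lra.
    right; f_equal; f_equal; [field; lra |].
    replace (((1 + sqrt 2) / 6) ^ 2) with ((1 + 2 * sqrt 2 + sqrt 2 * sqrt 2) / 36) by field.
    rewrite Hqq; field; lra.
Qed.
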